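(* For all integers $n\geq1$ and $d\geq1$, the restriction of $f_n^d\in\mathrm{Inv}(I^n,A)$ to $I^{n+1}\subset I^n$ is $$(f_n^d)_{|I^{n+1}}=\sum_{\frac d2\leq k\leq d}\binom{k}{d-k}\,\delta(A)^{2k-d}\,\{-1\}^{(d-k)(n-1)}\,f_{n+1}^k.$$
   Context: Setting. $k$ is a field of characteristic $\neq 2$ (in the displayed sum, $k$ is a summation index); $K,L$ denote field extensions of the base field. Quadratic forms are nondegenerate. $GW(K)$, $W(K)$ are the Grothendieck–Witt and Witt rings; $\hat I(K)\subset GW(K)$ is the ideal of elements of virtual dimension $0$ and $I(K)\subset W(K)$ the fundamental ideal; the projection $\hat I(K)\to I(K)$ is an isomorphism, and $\hat I^n(K)$ and $I^n(K)$ are identified. $\langle\langle a\rangle\rangle=\langle1\rangle-\langle a\rangle\in\hat I(K)$, $\langle\langle a_1,\dots,a_n\rangle\rangle=\prod\langle\langle a_i\rangle\rangle$, and $\mathrm{Pf}_n(K)$ is the set of these $n$-fold Pfister elements. For functors $F$ (to sets) and $H$ (to abelian groups) on field extensions of $k$, $\mathrm{Inv}(F,H)$ is the group of natural transformations $F\to H$. $A$ is a functor from field extensions of $k$ to filtered commutative rings $A(K)=A^0(K)\supset A^1(K)\supset\cdots$, with $\bigcap_nA^n(K)=0$, together with a natural map $f_1:I(K)\to A^1(K)$ such that: (i) $\langle\langle a_1,\dots,a_n\rangle\rangle\mapsto\{a_1,\dots,a_n\}:=f_1(\langle\langle a_1\rangle\rangle)\cdots f_1(\langle\langle a_n\rangle\rangle)$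 is a well-defined injective map $\mathrm{Pf}_n(K)\to A^n(K)$; (ii) for all $n\geq1$ this map extends to a group morphism $f_n:I^n(K)\to A^n(K)$; (iii) if $x\in A(K)$ satisfies $\{a\}\cdot x\in A^{d+1}(L)$ for all extensions $L/K$ and all $a\in L^*$, then $x\in A^d(K)$; (iv) for all $K$ and $n\geq 1$, every invariant of $\mathrm{Pf}_n$ over $K$ (i.e. on extensions of $K$) with values in $A$ is uniquely of the form $x+y f_n$ with $x,y\in A(K)$. (Examples: $A=W$ with $f_1=\mathrm{Id}$; $A=H^*(-,\mu_2)$ with $f_1=e_1$.) Let $\pi_n(t)=1-\frac{2}{1+(1+2^nt)^{1/2^{n-1}}}\in t+t^2\mathbb{Z}[[t]]$ and, for $x\in GW(K)$, let $\pi_n^d(x)$ be the coefficient of $t^d$ in $\lambda_{\pi_n(t)}(x)$, where $\lambda_t(x)=\sum\lambda^d(x)t^d$ for the usual exterior power operations of $GW(K)$. Then $\pi_n^d$ maps $I^n(K)$ to $I^{nd}(K)$; put $f_n^d=f_{nd}\circ\pi_n^d\in\mathrm{Inv}(I^n,A^{nd})$ for $d\geq1$ and $f_n^0=1$. $\{-1\}=f_1(\langle\langle-1\rangle\rangle)$. The element $\delta(A)\in A(k)$ ($k$ the base field) is the unique element such that the restriction of $f_1$ to $I^2$ equals $\delta(A)f_2$ (it is $1$ for $A=W$ and $0$ for $A=H^*(-,\mu_2)$). Zeroth powers are $1$. *)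

(* Defs.v *)
From HB Require Import structures.
From mathcomp Require Import all_boot all_order all_algebra perm generic_quotient.
From mathcomp Require Import boolp classical_sets.
From mathcomp.real_closed Require Import mxtens.
From mathcomp Require Import ring.

Set Implicit Arguments.
Unset Strict Implicit.
Unset Printing Implicit Defensive.

Import GRing.Theory.
Local Open Scope ring_scope.
Local Open Scope quotient_scope.

Section CauchyBinet.
Variable R : comNzRingType.

Definition incr_tuple d n : predArgType :=
  {t : d.-tuple 'I_n | sorted ltn (map val t)}.

Definition incr_fun d n (t : incr_tuple d n) (i : 'I_d) : 'I_n := tnth (val t) i.

Lemma incr_fun_inj d n (t : incr_tuple d n) : injective (incr_fun t).
Proof.
case: t => t st; rewrite /incr_fun /=; apply/tuple_uniqP.
rewrite -(map_inj_uniq val_inj).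
exact: (sorted_uniq ltn_trans ltnn).
Qed.

Lemma incr_fun_perm_inj d n (t t' : incr_tuple d n) (s s' : 'S_d) :
  (forall i, incr_fun t (s i) = incr_fun t' (s' i)) -> t = t' /\ s = s'.
Proof.
move=> H.
have tt' : t = t'.
  apply: val_inj; apply: val_inj; apply: (inj_map val_inj).
  apply: (irr_sorted_eq ltn_trans ltnn (valP t) (valP t')) => x.
  suff sub (u v : incr_tuple d n) (a b : 'S_d) :
    (forall i, incr_fun u (a i) = incr_fun v (b i)) ->
    {subset map val (val u) <= map val (val v)}.
    by apply/idP/idP; [apply: (sub _ _ s s') | apply: (sub _ _ s' s)].
  move=> {}H y /mapP[z /tnthP[i ->] ->]; apply: map_f.
  have := H ((a^-1)%g i); rewrite /incr_fun permKV => ->; exact: mem_tnth.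
split=> //; apply/permP => i; apply: (@incr_fun_inj _ _ t).
by rewrite H tt'.
Qed.

Lemma Cauchy_Binet d n (A : 'M[R]_(d, n)) (B : 'M[R]_(n, d)) :
  \det (A *m B) =
    \sum_(t : incr_tuple d n) \det (colsub (incr_fun t) A) * \det (rowsub (incr_fun t) B).
Proof.
have -> : \det (A *m B) =
  \sum_(f : {ffun 'I_d -> 'I_n}) (\prod_i A i (f i)) * \det (rowsub f B).
  rewrite /determinant.
  under eq_bigr => s _ do under eq_bigr => i _ do rewrite mxE.
  under eq_bigr => s _ do rewrite bigA_distr_bigA mulr_sumr.
  rewrite exchange_big; apply: eq_bigr => f _ /=; rewrite mulr_sumr.
  apply: eq_bigr => s _; rewrite big_split /= mulrCA; congr (_ * (_ * _)).
  by apply: eq_bigr => i _; rewrite mxE.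
rewrite (bigID [pred f : {ffun 'I_d -> 'I_n} | injectiveb f]) /=.
rewrite [X in _ + X]big1 ?addr0; last first.
  move=> f /injectivePn[i [j ij fij]].
  by rewrite (determinant_alternate ij) ?mulr0 // => k; rewrite !mxE fij.
pose h (p : incr_tuple d n * 'S_d) : {ffun 'I_d -> 'I_n} :=
  [ffun i => incr_fun p.1 (p.2 i)].
have h_inj : injective h.
  move=> [t s] [t' s'] /ffunP H; have [|-> ->//] := @incr_fun_perm_inj _ _ t t' s s'.
  by move=> i; have := H i; rewrite !ffunE.
have hE : [set f : {ffun 'I_d -> 'I_n} | injectiveb f] = [set h p | p : _ * _]%SET.
  apply/esym/eqP; rewrite eqEcard; apply/andP; split.
    apply/fintype.subsetP => f /imsetP[[t s] _ ->]; rewrite inE; apply/injectiveP => i j.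
    by rewrite !ffunE => /incr_fun_inj/perm_inj.
  rewrite card_inj_ffuns !card_ord card_imset // card_prod card_Sn.
  by rewrite card_sig -cardsE card_ltn_sorted_tuples bin_ffact.
transitivity (\sum_(f in [set h p | p : _ * _]%SET)
   (\prod_i A i (f i)) * \det (rowsub f B)).
  by apply: eq_bigl => f; rewrite -hE inE.
rewrite big_imset /=; last by move=> p q _ _; apply: h_inj.
transitivity (\sum_(t : incr_tuple d n) \sum_(s : 'S_d)
    (-1) ^+ s * \prod_i (colsub (incr_fun t) A) i (s i) * \det (rowsub (incr_fun t) B)).
  rewrite pair_bigA /=; apply: eq_big => [p|[t s] _] /=; first by rewrite inE.
  have -> : rowsub (h (t, s)) B = row_perm s (rowsub (incr_fun t) B).
    by apply/matrixP => i j; rewrite !mxE ffunE.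
  rewrite row_permE det_mulmx det_perm mulrCA mulrA; congr (_ * _ * _).
  by apply: eq_bigr => i _; rewrite mxE ffunE.
by apply: eq_bigr => t _; rewrite [X in _ = X * _]/determinant mulr_suml.
Qed.

End CauchyBinet.

Section Grothendieck.
Variable S : comPzSemiRingType.

Definition groth_rel (p q : S * S) : bool :=
  `[< exists r : S, p.1 + q.2 + r = q.1 + p.2 + r >].

Lemma groth_rel_refl : reflexive groth_rel.
Proof. by move=> p; apply/asboolP; exists 0. Qed.

Lemma groth_rel_sym : symmetric groth_rel.
Proof. by move=> p q; apply/asboolP/asboolP => -[r e]; exists r. Qed.

Lemma groth_rel_trans : transitive groth_rel.
Proof.
move=> q p s /asboolP[r e] /asboolP[r' e']; apply/asboolP; exists (q.1 + q.2 + r + r').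
transitivity ((p.1 + q.2 + r) + (q.1 + s.2 + r')); first by ring.
by rewrite e e'; ring.
Qed.

Canonical groth_equiv :=
  EquivRel groth_rel groth_rel_refl groth_rel_sym groth_rel_trans.

Definition groth := {eq_quot groth_rel}.

HB.instance Definition _ := Choice.on groth.
HB.instance Definition _ := EqQuotient.on groth.

Lemma groth_eqP (p q : S * S) :
  (exists r : S, p.1 + q.2 + r = q.1 + p.2 + r) -> \pi_groth p = \pi_groth q.
Proof. by move=> e; apply/eqmodP/asboolP. Qed.

Lemma groth_reprP (p : S * S) : exists r : S,
  (repr (\pi_groth p)).1 + p.2 + r = p.1 + (repr (\pi_groth p)).2 + r.
Proof. by have /eqmodP/asboolP := reprK (\pi_groth p). Qed.

Definition groth_add (x y : groth) : groth :=
  \pi_groth ((repr x).1 + (repr y).1, (repr x).2 + (repr y).2).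
Definition groth_opp (x : groth) : groth := \pi_groth ((repr x).2, (repr x).1).
Definition groth_mul (x y : groth) : groth :=
  \pi_groth ((repr x).1 * (repr y).1 + (repr x).2 * (repr y).2,
             (repr x).1 * (repr y).2 + (repr x).2 * (repr y).1).

Definition to_groth (s : S) : groth := \pi_groth (s, 0).

Lemma groth_addE (p q : S * S) :
  groth_add (\pi_groth p) (\pi_groth q) = \pi_groth (p.1 + q.1, p.2 + q.2).
Proof.
apply: groth_eqP => /=; have [r e] := groth_reprP p; have [r' e'] := groth_reprP q.
exists (r + r'); move: e e'; case: (repr _) => a b; case: (repr _) => c d /= e e'.
transitivity ((a + p.2 + r) + (c + q.2 + r')); first by ring.
by rewrite e e'; ring.
Qed.

Lemma groth_oppE (p : S * S) : groth_opp (\pi_groth p) = \pi_groth (p.2, p.1).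
Proof.
apply: groth_eqP => /=; have [r e] := groth_reprP p; exists r.
by rewrite [X in X + _]addrC -e [in RHS]addrC [p.2 + _]addrC addrC.
Qed.

Lemma groth_mulE (p q : S * S) :
  groth_mul (\pi_groth p) (\pi_groth q) =
  \pi_groth (p.1 * q.1 + p.2 * q.2, p.1 * q.2 + p.2 * q.1).
Proof.
apply: groth_eqP => /=; have [r e] := groth_reprP p; have [r' e'] := groth_reprP q.
move: e e'; case: (repr _) => a b; case: (repr _) => c d; case: p => p1 p2.
case: q => q1 q2 /= e e'.
exists (p2 * c + p1 * d + r * c + r * d + p1 * c + p2 * d + p1 * r' + p2 * r').
transitivity ((a + p2 + r) * c + (p1 + b + r) * d +
              p1 * (c + q2 + r') + p2 * (q1 + d + r')); first by ring.
transitivity ((p1 + b + r) * c + (a + p2 + r) * d +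
              p1 * (q1 + d + r') + p2 * (c + q2 + r')); last by ring.
by rewrite e e'.
Qed.

Lemma grothW (P : groth -> Prop) : (forall p, P (\pi_groth p)) -> forall x, P x.
Proof. by move=> H x; rewrite -[x]reprK. Qed.

Fact groth_addA : associative groth_add.
Proof.
by move=> x y z; elim/grothW: x => x; elim/grothW: y => y; elim/grothW: z => z;
  rewrite !groth_addE /= !addrA.
Qed.

Fact groth_addC : commutative groth_add.
Proof.
by move=> x y; rewrite /groth_add; congr (\pi_groth (_, _)); rewrite addrC.
Qed.

Fact groth_add0 : left_id (to_groth 0) groth_add.
Proof. by move=> x; elim/grothW: x => -[a b]; rewrite groth_addE /= !add0r. Qed.

Fact groth_addN : left_inverse (to_groth 0) groth_opp groth_add.
Proof.
move=> x; elim/grothW: x => -[a b]; rewrite groth_oppE groth_addE.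
by apply: groth_eqP; exists 0 => /=; ring.
Qed.

HB.instance Definition _ :=
  GRing.isZmodule.Build groth groth_addA groth_addC groth_add0 groth_addN.

Fact groth_mulA : associative groth_mul.
Proof.
move=> x y z; elim/grothW: x => x; elim/grothW: y => y; elim/grothW: z => z.
by rewrite !groth_mulE /=; congr (\pi_groth (_, _)); ring.
Qed.

Fact groth_mulC : commutative groth_mul.
Proof.
by move=> x y; rewrite /groth_mul; congr (\pi_groth (_, _)); ring.
Qed.

Fact groth_mul1 : left_id (to_groth 1) groth_mul.
Proof.
move=> x; elim/grothW: x => -[a b]; rewrite groth_mulE /=.
by congr (\pi_groth (_, _)); ring.
Qed.

Fact groth_mulDl : left_distributive groth_mul +%R.
Proof.
move=> x y z; elim/grothW: x => x; elim/grothW: y => y; elim/grothW: z => z.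
have addE p q : \pi_groth p + \pi_groth q = \pi_groth (p.1 + q.1, p.2 + q.2).
  exact: groth_addE.
rewrite addE !groth_mulE addE /=.
by congr (\pi_groth (_, _)); ring.
Qed.

HB.instance Definition _ := GRing.Zmodule_isComPzRing.Build groth
  groth_mulA groth_mulC groth_mul1 groth_mulDl.

End Grothendieck.

Section ExteriorPowerMatrix.
Variable R : comNzRingType.

(* Matrix of the d-th exterior power of a linear map, in the bases formed by   *)
(* the e_(t 0) /\ ... /\ e_(t (d - 1)) with t increasing.  If B is the Gram    *)
(* matrix of a bilinear form b, this is also the Gram matrix of the form       *)
(* (u_1 /\ ... /\ u_d, v_1 /\ ... /\ v_d) |-> det (b(u_i, v_j)).               *)
Definition ext_mx d m n (A : 'M[R]_(m, n)) :
    'M[R]_(#|incr_tuple d m|, #|incr_tuple d n|) :=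
  \matrix_(i, j) \det (mxsub (incr_fun (enum_val i)) (incr_fun (enum_val j)) A).

Lemma ext_mxM d m n p (A : 'M[R]_(m, n)) (B : 'M[R]_(n, p)) :
  ext_mx d (A *m B) = ext_mx d A *m ext_mx d B.
Proof.
apply/matrixP => i j; rewrite !mxE.
set f := incr_fun _; set g := incr_fun _.
have -> : mxsub f g (A *m B) = rowsub f A *m colsub g B.
  by apply/matrixP => a b; rewrite !mxE; apply: eq_bigr => k _; rewrite !mxE.
rewrite Cauchy_Binet.
rewrite (reindex (fun k : 'I_#|incr_tuple d n| => enum_val k)) /=; last exact/onW_bij/enum_val_bij.
apply: eq_bigr => k _; rewrite /ext_mx !mxE.
by congr (_ * _); congr (\det _); apply/matrixP => a b; rewrite !mxE.
Qed.

Lemma ext_mx1 d n : ext_mx d (1%:M : 'M[R]_n) = 1%:M.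
Proof.
apply/matrixP => i j; rewrite !mxE.
have [->|ij] := eqVneq i j.
  rewrite -[RHS](@det1 R d); congr (\det _); apply/matrixP => a b; rewrite !mxE.
  by rewrite (inj_eq (@incr_fun_inj _ _ _)).
apply/eqP/contraT => nz; case/negP: ij.
pose t := enum_val i; pose t' := enum_val j.
have {}nz : \det (mxsub (incr_fun t) (incr_fun t') (1%:M : 'M[R]_n)) != 0 by [].
have [s s0] : exists s : 'S_d, forall a, incr_fun t a = incr_fun t' (s a).
  apply: contrapT => /forallNP H; case/eqP: nz; rewrite /determinant big1 // => s _.
  have /existsNP[a /eqP/negPf ha] := H s.
  by rewrite (bigD1 a) //= !mxE ha mul0r mulr0.
have [] := @incr_fun_perm_inj _ _ t t' 1%g s; first by move=> a; rewrite perm1.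
by move=> /enum_val_inj->.
Qed.

Lemma ext_mx_tr d m n (A : 'M[R]_(m, n)) : ext_mx d A^T = (ext_mx d A)^T.
Proof.
apply/matrixP => i j; rewrite !mxE -det_tr; congr (\det _).
by apply/matrixP => a b; rewrite !mxE.
Qed.

End ExteriorPowerMatrix.

Lemma ext_mx_unit (K : fieldType) d n (A : 'M[K]_n) :
  A \in unitmx -> ext_mx d A \in unitmx.
Proof.
move=> uA; suff /mulmx1_unit[] : ext_mx d A *m ext_mx d (invmx A) = 1%:M by [].
by rewrite -ext_mxM mulmxV // ext_mx1.
Qed.

Section QuadraticForms.
Variable K : fieldType.

(* In characteristic different from 2, a nondegenerate quadratic form          *)
(* x |-> x B x^T is the same thing as its symmetric invertible Gram matrix B.  *)
Record qform := QForm {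
  qform_val : {n : nat & 'M[K]_n};
  _ : ((tagged qform_val)^T == tagged qform_val) && (tagged qform_val \in unitmx)
}.

HB.instance Definition _ := [isSub for qform_val].
HB.instance Definition _ := [Choice of qform by <:].

Definition qdim (q : qform) : nat := tag (qform_val q).
Definition qmx (q : qform) : 'M[K]_(qdim q) := tagged (qform_val q).

Lemma qmx_sym q : (qmx q)^T = qmx q.
Proof. by have /andP[/eqP] := valP q. Qed.

Lemma qmx_unit q : qmx q \in unitmx.
Proof. by have /andP[] := valP q. Qed.

Fact mkq_subproof n (B : 'M[K]_n) : B^T = B -> B \in unitmx ->
  (B^T == B) && (B \in unitmx).
Proof. by move=> -> ->; rewrite eqxx. Qed.

Definition mkq n (B : 'M[K]_n) (sB : B^T = B) (uB : B \in unitmx) : qform :=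
  @QForm (Tagged (fun n => 'M[K]_n) B) (mkq_subproof sB uB).

Definition isometric (q q' : qform) : Prop :=
  exists (P : 'M[K]_(qdim q, qdim q')) (Q : 'M[K]_(qdim q', qdim q)),
    [/\ P *m Q = 1%:M, Q *m P = 1%:M & P *m qmx q' *m P^T = qmx q].

Definition isom_rel (q q' : qform) : bool := `[< isometric q q' >].

Lemma isom_rel_refl : reflexive isom_rel.
Proof.
by move=> q; apply/asboolP; exists 1%:M, 1%:M; rewrite trmx1 !mul1mx !mulmx1.
Qed.

Lemma isometric_sym q q' : isometric q q' -> isometric q' q.
Proof.
case=> P [Q [PQ QP e]]; exists Q, P; split=> //.
by rewrite -e !mulmxA QP mul1mx -mulmxA -trmx_mul QP trmx1 mulmx1.
Qed.

Lemma isom_rel_sym : symmetric isom_rel.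
Proof. by move=> q q'; apply/asboolP/asboolP; apply: isometric_sym. Qed.

Lemma isom_rel_trans : transitive isom_rel.
Proof.
move=> q' q q'' /asboolP[P [Q [PQ QP e]]] /asboolP[P' [Q' [PQ' QP' e']]].
apply/asboolP; exists (P *m P'), (Q' *m Q); split.
- by rewrite mulmxA -[P *m _ *m _]mulmxA PQ' mulmx1.
- by rewrite mulmxA -[Q' *m _ *m _]mulmxA QP mulmx1.
- by rewrite trmx_mul !mulmxA -[P *m _ *m _]mulmxA -[P *m _ *m _]mulmxA e' e.
Qed.

Canonical isom_equiv := EquivRel isom_rel isom_rel_refl isom_rel_sym isom_rel_trans.

Fact qzero_sym : (0 : 'M[K]_0)^T = 0. Proof. exact: trmx0. Qed.
Fact qzero_unit : (0 : 'M[K]_0) \in unitmx. Proof. by rewrite unitmxE det_mx00 unitr1. Qed.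
Definition qzero : qform := mkq qzero_sym qzero_unit.

Fact qline_sym (a : K) : (a%:M : 'M[K]_1)^T = a%:M. Proof. exact: tr_scalar_mx. Qed.
Fact qline_unit (a : K) : ((if a == 0 then 1 else a)%:M : 'M[K]_1) \in unitmx.
Proof. by rewrite unitmxE det_scalar expr1 unitfE; case: ifPn => // _; apply: oner_neq0. Qed.
(* The form <a> for a != 0, with the dummy value <1> when a = 0.               *)
Definition qline (a : K) : qform := mkq (qline_sym _) (qline_unit a).

Fact qsum_sym q q' : (block_mx (qmx q) 0 0 (qmx q'))^T = block_mx (qmx q) 0 0 (qmx q').
Proof. by rewrite tr_block_mx !trmx0 !qmx_sym. Qed.
Fact qsum_unit q q' : block_mx (qmx q) 0 0 (qmx q') \in unitmx.
Proof. by rewrite unitmxE det_ublock unitrM -!unitmxE !qmx_unit. Qed.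
Definition qsum (q q' : qform) : qform := mkq (qsum_sym q q') (qsum_unit q q').

Fact qtens_sym q q' : (qmx q *t qmx q')^T = qmx q *t qmx q'.
Proof. by rewrite trmx_tens !qmx_sym. Qed.
Fact tens1mx1 m n : (1%:M : 'M[K]_m) *t (1%:M : 'M[K]_n) = 1%:M.
Proof.
apply/matrixP => i j; case: (mxtens_indexP i) => a b; case: (mxtens_indexP j) => c d.
rewrite tensmxE !mxE (can_eq (@mxtens_indexK _ _)) -natrM mulnb.
by congr (_%:R); rewrite xpair_eqE.
Qed.

Fact qtens_unit q q' : qmx q *t qmx q' \in unitmx.
Proof.
suff /mulmx1_unit[] : (qmx q *t qmx q') *m (invmx (qmx q) *t invmx (qmx q')) = 1%:M by [].
by rewrite tensmx_mul !mulmxV ?qmx_unit // tens1mx1.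
Qed.
Definition qtens (q q' : qform) : qform := mkq (qtens_sym q q') (qtens_unit q q').

Fact qext_sym d q : (ext_mx d (qmx q))^T = ext_mx d (qmx q).
Proof. by rewrite -ext_mx_tr qmx_sym. Qed.
Definition qext d (q : qform) : qform :=
  mkq (qext_sym d q) (ext_mx_unit d (qmx_unit q)).

Lemma qsum_isometric q1 q2 q1' q2' :
  isometric q1 q1' -> isometric q2 q2' -> isometric (qsum q1 q2) (qsum q1' q2').
Proof.
case=> P [Q [PQ QP e]] [P' [Q' [PQ' QP' e']]].
exists (block_mx P 0 0 P'), (block_mx Q 0 0 Q'); split.
- by rewrite mulmx_block !mul0mx !mulmx0 !addr0 !add0r PQ PQ' -scalar_mx_block.
- by rewrite mulmx_block !mul0mx !mulmx0 !addr0 !add0r QP QP' -scalar_mx_block.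
- change (block_mx P 0 0 P' *m block_mx (qmx q1') 0 0 (qmx q2') *m
    (block_mx P 0 0 P')^T = block_mx (qmx q1) 0 0 (qmx q2)).
  rewrite tr_block_mx !trmx0 !mulmx_block.
  by rewrite !(mul0mx, mulmx0, addr0, add0r) e e'.
Qed.

Lemma qtens_isometric q1 q2 q1' q2' :
  isometric q1 q1' -> isometric q2 q2' -> isometric (qtens q1 q2) (qtens q1' q2').
Proof.
case=> P [Q [PQ QP e]] [P' [Q' [PQ' QP' e']]].
exists (P *t P'), (Q *t Q'); split.
- by rewrite tensmx_mul PQ PQ' tens1mx1.
- by rewrite tensmx_mul QP QP' tens1mx1.
- by rewrite trmx_tens !tensmx_mul e e'.
Qed.

Lemma qext_isometric d q q' : isometric q q' -> isometric (qext d q) (qext d q').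
Proof.
case=> P [Q [PQ QP e]]; exists (ext_mx d P), (ext_mx d Q); split.
- by rewrite -ext_mxM PQ ext_mx1.
- by rewrite -ext_mxM QP ext_mx1.
- by rewrite -ext_mx_tr -!ext_mxM e.
Qed.

(* The Gram matrix of q is that of b : I -> I -> K for some indexing by I.     *)
Definition presents (I : Type) (b : I -> I -> K) (q : qform) : Prop :=
  exists e : 'I_(qdim q) -> I,
    bijective e /\ forall i j, qmx q i j = b (e i) (e j).

Lemma presents_isometric (I J : Type) (b : I -> I -> K) (c : J -> J -> K) (h : I -> J) q q' :
  bijective h -> (forall i j, b i j = c (h i) (h j)) ->
  presents b q -> presents c q' -> isometric q q'.
Proof.
case=> h' hK h'K bc [e [[e' eK e'K] eq]] [u [[u' uK u'K] uq]].
pose s i := u' (h (e i)); pose s' j := e' (h' (u j)).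
have sK : cancel s s' by move=> i; rewrite /s /s' u'K hK eK.
have s'K : cancel s' s by move=> j; rewrite /s /s' e'K h'K uK.
exists (rowsub s 1%:M), (rowsub s' 1%:M); split.
- by rewrite mul_rowsub_mx mul1mx; apply/matrixP => i j; rewrite !mxE sK.
- by rewrite mul_rowsub_mx mul1mx; apply/matrixP => i j; rewrite !mxE s'K.
- rewrite mul_rowsub_mx mul1mx; apply/matrixP => i j.
  rewrite !mxE (bigD1 (s j)) //= !mxE eqxx mulr1 big1 ?addr0; last first.
    by move=> k kj; rewrite !mxE eq_sym (negPf kj) mulr0.
  by rewrite eq uq bc /s !u'K.
Qed.

Lemma presentsT q : presents (qmx q) q.
Proof. by exists id; split=> //; exists id. Qed.

Lemma qsum_presents (I J : Type) (b : I -> I -> K) (c : J -> J -> K) q q' :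
  presents b q -> presents c q' ->
  presents (fun x y : I + J => match x, y with
    | inl i, inl i' => b i i' | inr j, inr j' => c j j' | _, _ => 0 end) (qsum q q').
Proof.
case=> e [[e' eK e'K] eq] [u [[u' uK u'K] uq]].
exists (fun k => match split (k : 'I_(qdim q + qdim q')) with
  inl i => inl (e i) | inr j => inr (u j) end); split.
  exists (fun x => match x with inl i => lshift (qdim q') (e' i)
                               | inr j => rshift (qdim q) (u' j) end).
    move=> k; rewrite -[RHS](@splitK (qdim q) (qdim q')).
    by case: split => i /=; rewrite ?eK ?uK.
  case=> i /=; first by rewrite (unsplitK (inl _)) e'K.
  by rewrite (unsplitK (inr _)) u'K.
move=> i j; rewrite -[i](@splitK (qdim q) (qdim q')) -[j](@splitK (qdim q) (qdim q')).
rewrite !unsplitK; case: (split i) => i'; case: (split j) => j' /=.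
- by rewrite [LHS]block_mxEul.
- by rewrite [LHS]block_mxEur mxE.
- by rewrite [LHS]block_mxEdl mxE.
- by rewrite [LHS]block_mxEdr.
Qed.

Lemma qtens_presents (I J : Type) (b : I -> I -> K) (c : J -> J -> K) q q' :
  presents b q -> presents c q' ->
  presents (fun x y : I * J => b x.1 y.1 * c x.2 y.2) (qtens q q').
Proof.
case=> e [[e' eK e'K] eq] [u [[u' uK u'K] uq]].
exists (fun k : 'I_(qdim q * qdim q') =>
  let p := mxtens_unindex k in (e p.1, u p.2)); split; last first.
  by move=> i j; rewrite [LHS]mxE /= eq uq.
exists (fun x => mxtens_index (e' x.1, u' x.2)).
  move=> k; rewrite /= eK uK -[RHS](@mxtens_unindexK (qdim q) (qdim q')).
  by congr mxtens_index; case: mxtens_unindex.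
by case=> i j; rewrite mxtens_indexK /= e'K u'K.
Qed.

Definition isoclass := {eq_quot isom_rel}.

HB.instance Definition _ := Choice.on isoclass.
HB.instance Definition _ := EqQuotient.on isoclass.

Lemma isoclass_eqP (q q' : qform) :
  isometric q q' <-> \pi_isoclass q = \pi_isoclass q'.
Proof. by split=> [e|/eqmodP/asboolP//]; apply/eqmodP/asboolP. Qed.

Lemma isoclassW (P : isoclass -> Prop) : (forall q, P (\pi_isoclass q)) -> forall x, P x.
Proof. by move=> H x; rewrite -[x]reprK. Qed.

Lemma isoclass_reprP (q : qform) : isometric (repr (\pi_isoclass q)) q.
Proof. by apply/isoclass_eqP; rewrite reprK. Qed.

Definition icl_add (x y : isoclass) : isoclass := \pi_isoclass (qsum (repr x) (repr y)).
Definition icl_mul (x y : isoclass) : isoclass := \pi_isoclass (qtens (repr x) (repr y)).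
Definition icl_ext d (x : isoclass) : isoclass := \pi_isoclass (qext d (repr x)).

Lemma icl_addE q q' : icl_add (\pi q) (\pi q') = \pi_isoclass (qsum q q').
Proof. by apply/isoclass_eqP/qsum_isometric; apply: isoclass_reprP. Qed.
Lemma icl_mulE q q' : icl_mul (\pi q) (\pi q') = \pi_isoclass (qtens q q').
Proof. by apply/isoclass_eqP/qtens_isometric; apply: isoclass_reprP. Qed.
Lemma icl_extE d q : icl_ext d (\pi q) = \pi_isoclass (qext d q).
Proof. by apply/isoclass_eqP/qext_isometric; apply: isoclass_reprP. Qed.

Fact icl_addA : associative icl_add.
Proof.
move=> x y z; elim/isoclassW: x => x; elim/isoclassW: y => y; elim/isoclassW: z => z.
rewrite (icl_addE y z) (icl_addE x y) (icl_addE x) (icl_addE _ z); apply/isoclass_eqP.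
pose h (t : 'I_(qdim x) + ('I_(qdim y) + 'I_(qdim z))) :=
  match t with inl i => inl (inl i) | inr (inl i) => inl (inr i) | inr (inr i) => inr i end.
apply: (@presents_isometric _ _ _ _ h); last 2 first.
- by apply: qsum_presents; [|apply: qsum_presents]; apply: presentsT.
- by apply: qsum_presents; [apply: qsum_presents|]; apply: presentsT.
- by exists (fun t => match t with inl (inl i) => inl i | inl (inr i) => inr (inl i)
    | inr i => inr (inr i) end); [case=> [i|[i|i]] | case=> [[i|i]|i]].
- by case=> [i|[i|i]] [j|[j|j]].
Qed.

Fact icl_addC : commutative icl_add.
Proof.
move=> x y; elim/isoclassW: x => x; elim/isoclassW: y => y.
rewrite !icl_addE; apply/isoclass_eqP.
pose h (I J : Type) (t : I + J) := match t with inl i => inr i | inr i => inl i end.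
apply: (@presents_isometric _ _ _ _ (@h _ _)); last 2 first.
- by apply: qsum_presents; apply: presentsT.
- by apply: qsum_presents; apply: presentsT.
- by exists (@h _ _); case.
- by case=> i [j|j].
Qed.

Fact icl_add0 : left_id (\pi_isoclass qzero) icl_add.
Proof.
move=> x; elim/isoclassW: x => x; rewrite !icl_addE; apply/isoclass_eqP.
apply: isometric_sym; apply: (@presents_isometric _ _ _ _ inr); last 2 first.
- exact: presentsT.
- by apply: qsum_presents; apply: presentsT.
- by exists (fun t : 'I_0 + 'I_(qdim x) => match t with inl i => False_rect _ (notF (ltn_ord i)) | inr j => j end) => // -[[]|].
- by [].
Qed.

Fact icl_mulA : associative icl_mul.
Proof.
move=> x y z; elim/isoclassW: x => x; elim/isoclassW: y => y; elim/isoclassW: z => z.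
rewrite (icl_mulE y z) (icl_mulE x y) (icl_mulE x) (icl_mulE _ z); apply/isoclass_eqP.
apply: (@presents_isometric _ _ _ _
  (fun t : 'I_(qdim x) * ('I_(qdim y) * 'I_(qdim z)) => ((t.1, t.2.1), t.2.2))); last 2 first.
- by apply: qtens_presents; [|apply: qtens_presents]; apply: presentsT.
- by apply: qtens_presents; [apply: qtens_presents|]; apply: presentsT.
- by exists (fun t => (t.1.1, (t.1.2, t.2))); [case=> i [j k] | case=> [[i j] k]].
- by case=> i [j k] [i' [j' k']] /=; rewrite mulrA.
Qed.

Fact icl_mulC : commutative icl_mul.
Proof.
move=> x y; elim/isoclassW: x => x; elim/isoclassW: y => y.
rewrite !icl_mulE; apply/isoclass_eqP.
apply: (@presents_isometric _ _ _ _ (fun t : 'I_(qdim x) * 'I_(qdim y) => (t.2, t.1)));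
  last 2 first.
- by apply: qtens_presents; apply: presentsT.
- by apply: qtens_presents; apply: presentsT.
- by exists (fun t => (t.2, t.1)); case.
- by move=> i j /=; rewrite mulrC.
Qed.

Fact icl_mul1 : left_id (\pi_isoclass (qline 1)) icl_mul.
Proof.
move=> x; elim/isoclassW: x => x; rewrite !icl_mulE; apply/isoclass_eqP.
apply: isometric_sym.
apply: (@presents_isometric _ _ _ _ (fun j => (ord0 : 'I_1, j))); last 2 first.
- exact: presentsT.
- by apply: qtens_presents; apply: presentsT.
- by exists snd => // -[i j] /=; rewrite [i]ord1.
- by move=> i j /=; rewrite /qmx /= [X in _ = X * _]mxE oner_eq0 mul1r.
Qed.

Fact icl_mul0 : left_zero (\pi_isoclass qzero) icl_mul.
Proof.
move=> x; elim/isoclassW: x => x; rewrite !icl_mulE; apply/isoclass_eqP.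
apply: (@presents_isometric _ _ _ _ (fun t : 'I_0 * 'I_(qdim x) => t.1)); last 2 first.
- by apply: qtens_presents; apply: presentsT.
- exact: presentsT.
- by exists (fun i : 'I_0 => False_rect _ (notF (ltn_ord i))) => -[[]].
- by case=> [[]].
Qed.

Fact icl_mulDl : left_distributive icl_mul icl_add.
Proof.
move=> x y z; elim/isoclassW: x => x; elim/isoclassW: y => y; elim/isoclassW: z => z.
rewrite (icl_addE x y) (icl_mulE x z) (icl_mulE y z) icl_mulE icl_addE; apply/isoclass_eqP.
apply: (@presents_isometric _ _ _ _
  (fun t : ('I_(qdim x) + 'I_(qdim y)) * 'I_(qdim z) =>
    match t with (inl i, k) => inl (i, k) | (inr j, k) => inr (j, k) end)); last 2 first.
- by apply: qtens_presents; [apply: qsum_presents|]; apply: presentsT.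
- by apply: qsum_presents; apply: qtens_presents; apply: presentsT.
- by exists (fun t => match t with inl (i, k) => (inl i, k) | inr (j, k) => (inr j, k) end);
    [case=> [[i|j] k] | case=> [[i k]|[j k]]].
- by case=> [[i|j] k] [[i'|j'] k'] //=; rewrite mul0r.
Qed.

HB.instance Definition _ :=
  GRing.isNmodule.Build isoclass icl_addA icl_addC icl_add0.
HB.instance Definition _ := GRing.Nmodule_isComPzSemiRing.Build isoclass
  icl_mulA icl_mulC icl_mul1 icl_mulDl icl_mul0.

End QuadraticForms.

Notation GW K := (groth (isoclass K)).

Section PowerSeries.
Variable R : pzRingType.
Implicit Types f g : nat -> R.

(* A power series is the sequence of its coefficients.                         *)
Definition ps_one : nat -> R := fun d => (d == 0%N)%:R.
Definition ps_mul f g : nat -> R := fun d => \sum_(i < d.+1) f i * g (d - i)%N.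
Definition ps_exp f (m : nat) : nat -> R := iter m (ps_mul f) ps_one.

(* The inverse of f as the geometric series in 1 - f, when f 0 = 1.            *)
Definition ps_inv f : nat -> R :=
  fun d => \sum_(m < d.+1) ps_exp (fun i => ps_one i - f i) m d.

End PowerSeries.

(* Generalized binomial coefficients: (1 + t)^a = \sum_i gbin a i t^i.         *)
Definition gbin (a : rat) (i : nat) : rat :=
  (\prod_(j < i) (a - j%:R)) / (i`!)%:R.

(* (1 + 2^n t)^(1 / 2^(n-1))                                                   *)
Definition root_ser (n : nat) : nat -> rat :=
  fun i => gbin (2%:R ^- n.-1) i * (2%:R ^+ n) ^+ i.

(* pi_n(t) = 1 - 2 / (1 + (1 + 2^n t)^(1/2^(n-1))); the series that is         *)
(* inverted is halved first, so as to have constant term 1.                    *)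
Definition pi_rat_ser (n : nat) : nat -> rat :=
  fun i => ps_one rat i -
    ps_inv (fun j => (ps_one rat j + root_ser n j) / 2%:R) i.

(* The coefficients of pi_n(t) are integers, hence equal to their numerators.  *)
Definition pi_ser (n : nat) : nat -> int := fun i => numq (pi_rat_ser n i).

Section GrothendieckWitt.
Variable K : fieldType.

Definition gw_line (a : K) : GW K := to_groth (\pi_(isoclass K) (qline a)).

Definition pf1 (a : K) : GW K := 1 - gw_line a.

Definition pfister (s : seq K) : GW K := \prod_(a <- s) pf1 a.

Definition Pf (n : nat) : set (GW K) :=
  [set x | exists s : n.-tuple K, (forall a, a \in s -> a != 0) /\ x = pfister s].

Definition gw_dim (x : GW K) : int :=
  (qdim (repr (repr x).1))%:Z - (qdim (repr (repr x).2))%:Z.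

(* lambda_t(q - q') = lambda_t(q) / lambda_t(q') for actual forms q and q'     *)
Definition gw_lambda (x : GW K) : nat -> GW K :=
  ps_mul (fun i => to_groth (icl_ext i (repr x).1))
         (ps_inv (fun i => to_groth (icl_ext i (repr x).2))).

(* The coefficient of t^d in lambda_{pi_n(t)}(x).                              *)
Definition pi_op (n d : nat) (x : GW K) : GW K :=
  \sum_(i < d.+1) gw_lambda x i *~ ps_exp (pi_ser n) i d.

End GrothendieckWitt.

Section IdealPowers.
Variable R : comPzRingType.

Definition ideal_mul (I J : set R) : set R :=
  [set x | exists s : seq (R * R),
     (forall p, p \in s -> I p.1 /\ J p.2) /\ x = \sum_(p <- s) p.1 * p.2].

Fixpoint ideal_pow (I : set R) (n : nat) : set R :=
  if n is m.+1 then ideal_mul I (ideal_pow I m) else setT.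

End IdealPowers.

(* The projection GW(K) -> W(K) identifies the n-th power of the augmentation  *)
(* ideal of GW(K) with I^n(K); it is the former that is used for I^n(K).       *)
Definition fundI (K : fieldType) : set (GW K) := [set x | gw_dim x = 0].
Definition fundI_pow (n : nat) (K : fieldType) : set (GW K) := ideal_pow (@fundI K) n.

Section ScalarExtension.
Variables (K L : fieldType) (h : {rmorphism K -> L}).

Fact qmap_sym (q : qform K) : (map_mx h (qmx q))^T = map_mx h (qmx q).
Proof. by rewrite map_trmx qmx_sym. Qed.
Fact qmap_unit (q : qform K) : map_mx h (qmx q) \in unitmx.
Proof. by rewrite map_unitmx qmx_unit. Qed.
Definition qmap (q : qform K) : qform L := mkq (qmap_sym q) (qmap_unit q).

Lemma qmap_isometric q q' : isometric q q' -> isometric (qmap q) (qmap q').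
Proof.
case=> P [Q [PQ QP e]]; exists (map_mx h P), (map_mx h Q); split.
- by rewrite -map_mxM PQ map_mx1.
- by rewrite -map_mxM QP map_mx1.
- by rewrite map_trmx -!map_mxM e.
Qed.

Definition icl_map (x : isoclass K) : isoclass L := \pi_(isoclass L) (qmap (repr x)).

Definition gw_map (x : GW K) : GW L :=
  to_groth (icl_map (repr x).1) - to_groth (icl_map (repr x).2).

End ScalarExtension.

Record field_ext (k : fieldType) := FieldExt {
  fe_field :> fieldType;
  fe_emb : {rmorphism k -> fe_field}
}.

Record fe_hom (k : fieldType) (K L : field_ext k) := FieldExtHom {
  fe_fun :> {rmorphism K -> L};
  fe_funP : forall x : k, fe_fun (fe_emb K x) = fe_emb L x
}.

Definition fe_base (k : fieldType) : field_ext k :=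
  FieldExt (idfun : {rmorphism k -> k}).

Definition fe_base_hom (k : fieldType) (K : field_ext k) : fe_hom (fe_base k) K :=
  @FieldExtHom k (fe_base k) K (fe_emb K) (fun=> erefl).

Record filtered_ring_functor (k : fieldType) := FilteredRingFunctor {
  frf_ring :> field_ext k -> comPzRingType;
  frf_map : forall K L : field_ext k,
    fe_hom K L -> {rmorphism frf_ring K -> frf_ring L};
  frf_fil : forall K : field_ext k, nat -> set (frf_ring K);
  frf_map_id : forall (K : field_ext k) (h : fe_hom K K),
    h =1 id -> frf_map h =1 id;
  frf_map_comp : forall (K L M : field_ext k)
      (f : fe_hom K L) (g : fe_hom L M) (h : fe_hom K M),
    h =1 g \o f -> frf_map h =1 frf_map g \o frf_map f;
  frf_fil0 : forall (K : field_ext k) (x : frf_ring K), frf_fil 0 x;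
  frf_filS : forall (K : field_ext k) n (x : frf_ring K),
    frf_fil n.+1 x -> frf_fil n x;
  frf_fil_zero : forall (K : field_ext k) n, frf_fil n (0 : frf_ring K);
  frf_filB : forall (K : field_ext k) n (x y : frf_ring K),
    frf_fil n x -> frf_fil n y -> frf_fil n (x - y);
  frf_filM : forall (K : field_ext k) m n (x y : frf_ring K),
    frf_fil m x -> frf_fil n y -> frf_fil (m + n) (x * y);
  frf_fil_map : forall (K L : field_ext k) (h : fe_hom K L) n (x : frf_ring K),
    frf_fil n x -> frf_fil n (frf_map h x);
  frf_fil_sep : forall (K : field_ext k) (x : frf_ring K),
    (forall n, frf_fil n x) -> x = 0
}.

Section Invariants.
Variables (k : fieldType) (A : filtered_ring_functor k).

(* Naturality of an invariant of Pf_n over K, i.e. of a family indexed by the  *)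
(* extensions L / K; only the values on Pf_n(L) are relevant.                  *)
Definition is_Pf_invariant (n : nat) (K : field_ext k)
    (alpha : forall L : field_ext k, fe_hom K L -> GW L -> A L) : Prop :=
  forall (L M : field_ext k) (h : fe_hom K L) (h' : fe_hom K M) (g : fe_hom L M),
    h' =1 g \o h ->
    forall x : GW L, Pf n x -> alpha M h' (gw_map g x) = frf_map A g (alpha L h x).

(* {a_1, ..., a_n} = f_1(<<a_1>>) ... f_1(<<a_n>>)                             *)
Definition symb (f1 : forall K : field_ext k, GW K -> A K) (K : field_ext k)
    (s : seq K) : A K := \prod_(a <- s) f1 K (pf1 a).

End Invariants.

(* The maps f_n for n >= 1 are given as functions on GW(K), of which only the  *)
(* restriction to I^n(K) matters.                                              *)
Record coefficient_theory (k : fieldType) := CoefficientTheory {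
  ct_functor :> filtered_ring_functor k;
  ct_f : nat -> forall K : field_ext k, GW K -> ct_functor K;
  ct_f1_natural : forall (K L : field_ext k) (h : fe_hom K L) (x : GW K),
    fundI_pow 1 x -> ct_f 1 (gw_map h x) = frf_map ct_functor h (ct_f 1 x);
  ct_f_fil : forall n (K : field_ext k) (x : GW K), (0 < n)%N ->
    fundI_pow n x -> frf_fil n (ct_f n x);
  ct_f_add : forall n (K : field_ext k) (x y : GW K), (0 < n)%N ->
    fundI_pow n x -> fundI_pow n y -> ct_f n (x + y) = ct_f n x + ct_f n y;
  ct_symb_inj : forall n (K : field_ext k) (s s' : n.-tuple K),
    (forall a, a \in s -> a != 0) -> (forall a, a \in s' -> a != 0) ->
    pfister s = pfister s' <-> symb (ct_f 1) s = symb (ct_f 1) s';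
  ct_f_pfister : forall n (K : field_ext k) (s : n.-tuple K), (0 < n)%N ->
    (forall a, a \in s -> a != 0) -> ct_f n (pfister s) = symb (ct_f 1) s;
  ct_detect : forall (K : field_ext k) (d : nat) (x : ct_functor K),
    (forall (L : field_ext k) (h : fe_hom K L) (a : L), a != 0 ->
       frf_fil d.+1 (symb (ct_f 1) [:: a] * frf_map ct_functor h x)) ->
    frf_fil d x;
  ct_Pf_invariants : forall (K : field_ext k) (n : nat)
      (alpha : forall L : field_ext k, fe_hom K L -> GW L -> ct_functor L),
    (0 < n)%N -> is_Pf_invariant n alpha ->
    exists! xy : ct_functor K * ct_functor K,
      forall (L : field_ext k) (h : fe_hom K L) (z : GW L), Pf n z ->
        alpha L h z =
          frf_map ct_functor h xy.1 + frf_map ct_functor h xy.2 * ct_f n z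
}.

Section Operations.
Variables (k : fieldType) (A : coefficient_theory k).

(* delta(A), the unique element of A(k) such that f_1 = delta(A) f_2 on I^2.   *)
Definition delta : A (fe_base k) :=
  xget 0 [set y | forall (K : field_ext k) (x : GW K), fundI_pow 2 x ->
            ct_f A 1 x = frf_map A (fe_base_hom K) y * ct_f A 2 x].

Definition f_op (n d : nat) (K : field_ext k) (x : GW K) : A K :=
  if d is 0 then 1 else ct_f A (n * d) (pi_op n d x).

End Operations.

(* Main.v *)
From HB Require Import structures.
Require Import Defs.
From mathcomp Require Import all_boot all_order all_algebra perm generic_quotient.
From mathcomp Require Import boolp classical_sets.
From mathcomp Require Import ring zify.

Set Implicit Arguments.
Unset Strict Implicit.
Unset Printing Implicit Defensive.

Import GRing.Theory Num.Theory.
Local Open Scope ring_scope.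
Local Open Scope quotient_scope.

(** The formula comes from a relation between the series pi_n and pi_(n+1).  Since
    (1 + 2^n t)^2 = 1 + 2^(n+1) (t + 2^(n-1) t^2), one has
    pi_n(t) = pi_(n+1)(t + 2^(n-1) t^2) (pi_ser_rec).  Comparing coefficients, for every
    u in GW(K),

      pi_n^d(u) = sum_k C(k, d-k) 2^((d-k)(n-1)) pi_(n+1)^k(u)      (pi_op_rec).

    If u lies in I^(n+1), then pi_(n+1)^k(u) lies in I^((n+1)k) (pi_op_pow).  On the
    augmentation ideal, 2 acts as <<-1>> because hyperbolic planes are killed by forms
    of dimension 0 (fundI_pow_2X), so the k-th term is <<-1>>^((d-k)(n-1)) pi_(n+1)^k(u),
    which lies not only in I^(nd) but in I^(nd + 2k - d).  It remains to apply f_(nd)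
    to each term: f_m restricts to delta^j f_(m+j) on I^(m+j) (ct_f_restrict), and
    f_(r+m)(<<-1>>^r y) = {-1}^r f_m(y) (ct_f_pf1XM).

    Two facts carry the rest.  First, I^n is additively generated by the n-fold
    Pfister forms (fundI_pow_ind), through the diagonalization of quadratic forms;
    the two properties of f_m above are then checked on generators, using
    <<a, b>> = <<a>> + <<b>> - <<a b>>.  Secondly, lambda_(pi_n(t))(p) = 1 + p t for an n-fold
    Pfister form p.  As lambda_t turns sums into products, this gives pi_op_pow.  It is
    proved by working with the compositional inverse T_n of pi_n, which is defined by
    the recursion T_(n+1) = T_n + 2^(n-1) T_n^2: the same relation between <<a>>, <<b>>,
    <<a b>> and <<a, b>> shows by induction on n that lambda_s(p) = 1 + p T_n(s)
    (gw_lambda_ps_pfister).  That pi_n has integral coefficients follows as well, since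
    it is the inverse of an integral series with linear coefficient 1 (pi_serE). *)

(** * The ring of power series *)

(** An alias of the type of coefficient sequences, so that the ring structure
    given by the Cauchy product can be attached to it. *)
Definition ps (R : Type) := nat -> R.

Section PowerSeriesRing.
Variable R : comPzRingType.
Implicit Types f g h : ps R.

Lemma psP f g : (forall d, f d = g d) -> f = g.
Proof. exact: funext. Qed.

HB.instance Definition _ := gen_eqMixin (ps R).
HB.instance Definition _ := gen_choiceMixin (ps R).

Fact ps_addA : associative (fun f g : ps R => (fun d => f d + g d) : ps R).
Proof. by move=> f g h; apply: psP => d; rewrite addrA. Qed.
Fact ps_addC : commutative (fun f g : ps R => (fun d => f d + g d) : ps R).
Proof. by move=> f g; apply: psP => d; rewrite addrC. Qed.
Fact ps_add0 : left_id ((fun=> 0) : ps R) (fun f g => fun d => f d + g d).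
Proof. by move=> f; apply: psP => d; rewrite add0r. Qed.
Fact ps_addN : left_inverse ((fun=> 0) : ps R) (fun f d => - f d)
  (fun f g => fun d => f d + g d).
Proof. by move=> f; apply: psP => d; rewrite addNr. Qed.

HB.instance Definition _ :=
  GRing.isZmodule.Build (ps R) ps_addA ps_addC ps_add0 ps_addN.

Definition psmul : ps R -> ps R -> ps R := @ps_mul R.

Fact ps_mulC : commutative psmul.
Proof.
move=> f g; apply: psP => d; rewrite /psmul /ps_mul (reindex_inj rev_ord_inj) /=.
by apply: eq_bigr => i _; rewrite subSS subKn -1?ltnS // mulrC.
Qed.

Fact ps_mulA : associative psmul.
Proof.
move=> f g h; apply: psP => d.
rewrite [in RHS]ps_mulC /psmul /ps_mul.
pose c i j := f i * g j * h (d - i - j)%N.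
transitivity (\sum_(i < d.+1) \sum_(j < d.+1 | (j <= d - i)%N) c i j).
  apply: eq_bigr => i _; rewrite mulr_sumr.
  rewrite (big_ord_narrow_leq (leq_subr _ _)); apply: eq_bigr => j _.
  by rewrite /c mulrA.
transitivity (\sum_(i < d.+1) \sum_(m < d.+1 | (i <= d - m)%N) c i (d - i - m)%N).
  apply: eq_bigr => i _; rewrite (big_ord_narrow_leq (leq_subr _ _)).
  rewrite (reindex_inj rev_ord_inj) /=.
  have le_i : (i <= d)%N by rewrite -ltnS.
  under [RHS]eq_bigl => m.
    have -> : (i <= d - m)%N = (m <= d - i)%N by have := ltn_ord m; lia.
    over.
  rewrite (big_ord_narrow_leq (leq_subr _ _)); apply: eq_bigr => j _ /=.
  by rewrite subSS.
rewrite (exchange_big_dep predT) //=; apply: eq_bigr => m _.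
rewrite mulr_sumr (big_ord_narrow_leq (leq_subr _ _)); apply: eq_bigr => i _.
rewrite /c /= [RHS]mulrC subnAC; congr (_ * h _).
by have := ltn_ord m; have := ltn_ord i; lia.
Qed.

Fact ps_mul1 : left_id (ps_one R : ps R) psmul.
Proof.
move=> f; apply: psP => d; rewrite /psmul /ps_mul big_ord_recl /= mul1r subn0.
by rewrite big1 ?addr0 // => i _; rewrite /ps_one mul0r.
Qed.

Fact ps_mulDl : left_distributive psmul +%R.
Proof.
move=> f g h; apply: psP => d; rewrite /psmul /ps_mul -[RHS]big_split /=.
by apply: eq_bigr => i _; rewrite -mulrDl.
Qed.

HB.instance Definition _ := GRing.Zmodule_isComPzRing.Build (ps R)
  ps_mulA ps_mulC ps_mul1 ps_mulDl.

Lemma psDE f g d : (f + g) d = f d + g d. Proof. by []. Qed.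
Lemma psNE f d : (- f) d = - f d. Proof. by []. Qed.
Lemma ps1E d : (1 : ps R) d = (d == 0%N)%:R. Proof. by []. Qed.
Lemma psME f g d : (f * g) d = \sum_(i < d.+1) f i * g (d - i)%N. Proof. by []. Qed.
Lemma psMnE f n d : (f *+ n) d = f d *+ n.
Proof. by elim: n => // n IH; rewrite !mulrS psDE IH. Qed.
Lemma ps_sumE I (r : seq I) (P : pred I) (F : I -> ps R) d :
  (\sum_(i <- r | P i) F i) d = \sum_(i <- r | P i) F i d.
Proof. by elim/big_rec2: _ => // i x y _ <-. Qed.
Lemma ps_expE f m : ps_exp f m = f ^+ m :> ps R.
Proof. by elim: m => //= m ->; rewrite exprS. Qed.

Lemma psM_c0 f g : (f * g) 0%N = f 0%N * g 0%N.
Proof. by rewrite psME big_ord1. Qed.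
Lemma ps_exp_c0 f m : (f ^+ m) 0%N = f 0%N ^+ m.
Proof. by elim: m => // m IH; rewrite !exprS psM_c0 IH. Qed.

Definition psC (c : R) : ps R := fun d => c *+ (d == 0%N).
Definition psX : ps R := fun d => (d == 1%N)%:R.

Lemma psCME c f d : (psC c * f) d = c * f d.
Proof.
rewrite psME big_ord_recl subn0 big1 ?addr0 // => i _.
by rewrite /psC /= mulr0n mul0r.
Qed.

Fact psC_zmod : zmod_morphism psC.
Proof. by move=> a b; apply: psP => d; rewrite psDE psNE /psC mulrnBl. Qed.
Fact psC_monoid : monoid_morphism psC.
Proof.
split; first by apply: psP.
by move=> a b; apply: psP => d; rewrite psCME /psC mulrnAr.
Qed.
HB.instance Definition _ := GRing.isZmodMorphism.Build R (ps R) psC psC_zmod.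
HB.instance Definition _ := GRing.isMonoidMorphism.Build R (ps R) psC psC_monoid.

Lemma psXME f d : (psX * f) d = if d is d'.+1 then f d' else 0.
Proof.
case: d => [|d]; first by rewrite psM_c0 mul0r.
rewrite psME big_ord_recl mul0r add0r big_ord_recl /= mul1r subSS subn0.
by rewrite big1 ?addr0 // => i _; rewrite mul0r.
Qed.

Lemma psXnME f m d : (psX ^+ m * f) d = if (m <= d)%N then f (d - m)%N else 0.
Proof.
elim: m d => [|m IH] d; first by rewrite mul1r subn0.
by rewrite exprS -mulrA psXME; case: d => // d; rewrite IH.
Qed.

Lemma psXnE m d : (psX ^+ m) d = (d == m)%:R.
Proof.
rewrite -[_ ^+ m]mulr1 psXnME ps1E subn_eq0.
by case: ltngtP.
Qed.

Lemma ps_exp_coef0 f m d : f 0%N = 0 -> (d < m)%N -> (f ^+ m) d = 0.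
Proof.
move=> f0; elim: m d => // m IH d lt_dm; rewrite exprS psME big1 // => -[[|i] /= le_id] _.
  by rewrite f0 mul0r.
by rewrite IH ?mulr0 //; lia.
Qed.

Definition ps_comp f g : ps R := fun d => \sum_(i < d.+1) f i * (g ^+ i) d.

Lemma ps_comp_widen f g d N : g 0%N = 0 -> (d <= N)%N ->
  ps_comp f g d = \sum_(i < N.+1) f i * (g ^+ i) d.
Proof.
move=> g0 le_dN; rewrite /ps_comp (big_ord_widen N.+1 (fun i => f i * (g ^+ i) d)) ?ltnS //.
rewrite [RHS](bigID (fun i : 'I_N.+1 => (i < d.+1)%N)) /= [X in _ + X]big1 ?addr0 //.
by move=> i; rewrite -leqNgt => lt_di; rewrite ps_exp_coef0 ?mulr0.
Qed.

Lemma ps_compD f f' g : ps_comp (f + f') g = ps_comp f g + ps_comp f' g.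
Proof.
by apply: psP => d; rewrite psDE -big_split; apply: eq_bigr => i _; rewrite psDE mulrDl.
Qed.

Lemma ps_compMn f g n : ps_comp (f *+ n) g = ps_comp f g *+ n.
Proof.
elim: n => [|n IH]; last by rewrite !mulrS ps_compD IH.
by apply: psP => d; rewrite /ps_comp big1 // => i _; rewrite mul0r.
Qed.

Lemma ps_compC c g : ps_comp (psC c) g = psC c.
Proof.
apply: psP => d; rewrite /ps_comp big_ord_recl /= expr0 ps1E big1 ?addr0.
  by rewrite mulr_natr.
by move=> i _; rewrite mul0r.
Qed.

Lemma ps_comp1 g : ps_comp 1 g = 1.
Proof. exact: (ps_compC 1). Qed.

Lemma ps_compX g : g 0%N = 0 -> ps_comp psX g = g.
Proof.
move=> g0; apply: psP => -[|d]; first by rewrite /ps_comp big_ord1 mul0r g0.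
rewrite /ps_comp big_ord_recl mul0r add0r big_ord_recl /= mul1r expr1.
by rewrite big1 ?addr0 // => i _; rewrite mul0r.
Qed.

Lemma ps_compXr f : ps_comp f psX = f.
Proof.
apply: psP => d; rewrite /ps_comp big_ord_recr /= psXnE eqxx mulr1 big1 ?add0r // => i _.
by rewrite psXnE gtn_eqF ?mulr0.
Qed.

(** Both sides are the sum of f_i f'_j (g^(i+j))_d over all i, j <= d: the terms
    with i + j > d vanish because g has no constant term. *)
Lemma ps_compM f f' g : g 0%N = 0 ->
  ps_comp (f * f') g = ps_comp f g * ps_comp f' g.
Proof.
move=> g0; apply: psP => d.
have -> : (ps_comp f g * ps_comp f' g) d =
  \sum_(i < d.+1) \sum_(j < d.+1) f i * f' j * (g ^+ (i + j)) d.
  rewrite psME; under eq_bigr => e _ do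
    rewrite (@ps_comp_widen f g e d) -1?ltnS // (@ps_comp_widen f' g (d - e) d) ?leq_subr //
      big_distrlr /=.
  rewrite exchange_big; apply: eq_bigr => i _ /=; rewrite exchange_big.
  apply: eq_bigr => j _ /=; rewrite exprD psME mulr_sumr.
  by apply: eq_bigr => e _; rewrite mulrACA.
under [RHS]eq_bigr => i _.
  rewrite (bigID (fun j : 'I_d.+1 => (j <= d - i)%N)) /= [X in _ + X]big1 ?addr0; last first.
    by move=> j Hj; rewrite ps_exp_coef0 ?mulr0 //; have := ltn_ord i; lia.
  rewrite (big_ord_narrow_leq (leq_subr _ _)) /=.
  over.
rewrite /ps_comp.
transitivity (\sum_(m < d.+1) \sum_(i < d.+1 | (i <= m)%N) f i * f' (m - i)%N * (g ^+ m) d).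
  apply: eq_bigr => m _; rewrite psME mulr_suml.
  by rewrite (big_ord_narrow_leq (leq_ord m)).
rewrite (exchange_big_dep predT) //=; apply: eq_bigr => i _.
rewrite -(big_mkord (fun m => (i <= m)%N) (fun m => f i * f' (m - i)%N * (g ^+ m) d)).
have le_i : (i <= d)%N by rewrite -ltnS.
rewrite -(big_mkord xpredT (fun j => f i * f' j * (g ^+ (i + j)) d)).
rewrite (big_cat_nat (n := i)) //= ?leqW // big_nat_cond big_pred0 ?Monoid.simpm; last first.
  by move=> j /=; lia.
rewrite -[X in \sum_(X <= _ < _ | _) _](add0n (i : nat)) big_addn subSn //.
rewrite big_mkcond /=; apply: eq_big_nat => j _.
by rewrite leq_addl addnK addnC.
Qed.

Lemma ps_compXn f g m : g 0%N = 0 -> ps_comp (f ^+ m) g = ps_comp f g ^+ m.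
Proof.
by move=> g0; elim: m => [|m IH]; rewrite ?ps_comp1 // !exprS ps_compM // IH.
Qed.

Lemma ps_comp_c0 f g : (ps_comp f g) 0%N = f 0%N.
Proof. by rewrite /ps_comp big_ord1 expr0 mulr1. Qed.

Lemma ps_compA f g h : g 0%N = 0 -> h 0%N = 0 ->
  ps_comp (ps_comp f g) h = ps_comp f (ps_comp g h).
Proof.
move=> g0 h0; apply: psP => d; rewrite /ps_comp.
transitivity (\sum_(m < d.+1) \sum_(i < d.+1) f i * ((g ^+ i) m * (h ^+ m) d)).
  apply: eq_bigr => m _; rewrite -/(ps_comp f g m) (@ps_comp_widen f g m d) -1?ltnS //.
  by rewrite mulr_suml; apply: eq_bigr => i _; rewrite mulrA.
rewrite exchange_big; apply: eq_bigr => i _ /=.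
by rewrite -ps_compXn // /ps_comp mulr_sumr.
Qed.

Definition ps_geom : ps R := fun=> 1.
Lemma ps_geomP : ps_geom * (1 - psX) = 1.
Proof.
rewrite mulrC mulrBl mul1r; apply: psP => -[|d]; rewrite psDE psNE psXME ?subr0 //.
by rewrite subrr.
Qed.

(** The geometric series in 1 - f is the substitution of 1 - f into 1 / (1 - X),
    and f is the substitution of 1 - f into 1 - X. *)
Lemma ps_mulV f : f 0%N = 1 -> (ps_inv f : ps R) * f = 1.
Proof.
move=> f0; have g0 : (1 - f) 0%N = 0 by rewrite psDE psNE f0 subrr.
have -> : ps_inv f = ps_comp ps_geom (1 - f).
  by apply: psP => d; apply: eq_bigr => i _; rewrite mul1r ps_expE.
have {2}-> : f = ps_comp (1 - psX) (1 - f).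
  rewrite -mulN1r ps_compD ps_comp1 ps_compM // ps_compX //.
  have -> : (-1 : ps R) = psC (-1) by rewrite rmorphN1.
  by rewrite ps_compC rmorphN1 mulN1r opprB addrC subrK.
by rewrite -ps_compM // ps_geomP ps_comp1.
Qed.

Lemma ps_mulIf f : f 0%N = 1 -> injective (fun g => g * f).
Proof.
move=> f0 g h /(congr1 ( *%R (ps_inv f : ps R))).
by rewrite !(mulrCA (ps_inv f : ps R)) ps_mulV // !mulr1.
Qed.

End PowerSeriesRing.
Arguments psX {R}.

Section CoefficientMap.
Variables (R S : comPzRingType) (h : {rmorphism R -> S}).

Definition ps_map (f : ps R) : ps S := fun d => h (f d).

Fact ps_map_zmod : zmod_morphism ps_map.
Proof. by move=> f g; apply: psP => d; rewrite psDE psNE /ps_map psDE psNE rmorphB. Qed.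
Fact ps_map_monoid : monoid_morphism ps_map.
Proof.
split; first by apply: psP => d; rewrite /ps_map ps1E rmorph_nat.
move=> f g; apply: psP => d; rewrite /ps_map psME rmorph_sum /=.
by apply: eq_bigr => i _; rewrite rmorphM.
Qed.
HB.instance Definition _ := GRing.isZmodMorphism.Build (ps R) (ps S) ps_map ps_map_zmod.
HB.instance Definition _ :=
  GRing.isMonoidMorphism.Build (ps R) (ps S) ps_map ps_map_monoid.

Lemma ps_map_comp f g : ps_map (ps_comp f g) = ps_comp (ps_map f) (ps_map g).
Proof.
apply: psP => d; rewrite /ps_map /ps_comp rmorph_sum /=.
by apply: eq_bigr => i _; rewrite rmorphM -/(ps_map (g ^+ i) d) rmorphXn.
Qed.

Lemma ps_mapX : ps_map psX = psX.
Proof. by apply: psP => d; rewrite /ps_map rmorph_nat. Qed.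

Lemma ps_map_geom : ps_map (ps_geom R) = ps_geom S.
Proof. by apply: psP => d; apply: rmorph1. Qed.

End CoefficientMap.

(** * Substitution determines the inner series *)
Section CompositionAndRelations.
Variables (R S : comPzRingType) (E : R -> S -> Prop).
Hypotheses (E0 : E 0 0) (E1 : E 1 1).
Hypothesis EB : forall x x' y y', E x x' -> E y y' -> E (x - y) (x' - y').
Hypothesis EM : forall x x' y y', E x x' -> E y y' -> E (x * y) (x' * y').

Lemma ps_rel_sum n (F : 'I_n -> R) (F' : 'I_n -> S) :
  (forall i, E (F i) (F' i)) -> E (\sum_i F i) (\sum_i F' i).
Proof.
have EN x x' : E x x' -> E (- x) (- x') by move=> Exx; rewrite -[- x]sub0r -[- x']sub0r; apply: EB.
move=> EF; elim/big_rec2: _ => // i x y _ Exy.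
by rewrite -[x]opprK -[y]opprK; apply: EB; [apply: EF | apply: EN].
Qed.

(** When F = F_0 + X + O(X^2), the coefficient g_d is (F o g)_d minus a polynomial
    expression in the F_i and in g_1, ..., g_(d-1); hence any relation E that is
    compatible with the ring operations passes from F and F o g to g.  Equality
    gives cancellation, and membership in a subring gives integrality. *)
Lemma ps_comp_rel (F g : ps R) (F' g' : ps S) :
    F 1%N = 1 -> F' 1%N = 1 -> g 0%N = 0 -> g' 0%N = 0 ->
    (forall i, E (F i) (F' i)) ->
    (forall d, E (ps_comp F g d) (ps_comp F' g' d)) ->
  forall d, E (g d) (g' d).
Proof.
move=> F1 F'1 g0 g'0 EF Ecomp; elim/ltn_ind => -[_|d IH]; first by rewrite g0 g'0.
have Epow i e : (e < d.+1)%N -> E ((g ^+ i) e) ((g' ^+ i) e).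
  elim: i e => [|i IHi] e le_ed; first by rewrite !expr0 !ps1E; case: (_ == _).
  rewrite !exprS !psME; apply: ps_rel_sum => j.
  by apply: EM; [apply: IH | apply: IHi]; have := ltn_ord j; lia.
have Epow2 i : E ((g ^+ i.+2) d.+1) ((g' ^+ i.+2) d.+1).
  rewrite !(exprS _ i.+1) !psME; apply: ps_rel_sum => -[[|j] /= lt_j].
    by rewrite g0 g'0 !mul0r.
  have [lt_jd|ge_jd] := ltnP j d; last first.
    have -> : (d.+1 - j.+1 = 0)%N by lia.
    by rewrite !ps_exp_c0 g0 g'0 !expr0n !mulr0.
  by apply: EM; [apply: IH | apply: Epow]; lia.
(* the part of the coefficient d + 1 of F o g that only involves lower *)
(* coefficients of g                                                   *)
pose s (T : comPzRingType) (F g : ps T) := \sum_(i < d) F i.+2 * (g ^+ i.+2) d.+1.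
have gE (T : comPzRingType) (F0 g1 : ps T) : F0 1%N = 1 ->
    g1 d.+1 = ps_comp F0 g1 d.+1 - s T F0 g1.
  move=> F01; rewrite /ps_comp !big_ord_recl /= expr0 ps1E mulr0 add0r F01 mul1r expr1.
  by rewrite addrK.
rewrite (gE _ _ _ F1) (gE _ _ _ F'1); apply: EB => //.
by apply: ps_rel_sum => i; apply: EM.
Qed.

End CompositionAndRelations.

Lemma ps_comp_inj (R : comPzRingType) (F g g' : ps R) :
  F 1%N = 1 -> g 0%N = 0 -> g' 0%N = 0 -> ps_comp F g = ps_comp F g' -> g = g'.
Proof.
move=> F1 g0 g'0 eqF; apply: psP; apply: (@ps_comp_rel _ _ eq _ _ _ _ F g F g') => //.
- by move=> x x' y y' -> ->.
- by move=> x x' y y' -> ->.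
- by rewrite eqF.
Qed.

(** * The series pi_n and its compositional inverse *)

(** The series T with 1 + 2^(m+1) T = ((1 + s) / (1 - s))^(2^m), which is the
    compositional inverse of pi_(m+1).  Squaring 1 + 2^(m+1) T gives this recursion,
    from which the integrality of the coefficients is visible. *)
Fixpoint pi_inv_ser (m : nat) : ps int :=
  if m is m'.+1 then pi_inv_ser m' + pi_inv_ser m' ^+ 2 *+ 2 ^ m' else psX * ps_geom int.

Lemma pi_inv_ser_c0 m : pi_inv_ser m 0%N = 0.
Proof.
elim: m => [|m IH] /=; first by rewrite psXME.
by rewrite psDE psMnE ps_exp_c0 IH expr0n mul0rn addr0.
Qed.

Lemma pi_inv_ser_c1 m : pi_inv_ser m 1%N = 1.
Proof.
have step (f : ps int) n : f 0%N = 0 -> f 1%N = 1 -> (f + f ^+ 2 *+ n) 1%N = 1.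
  move=> f0 f1; rewrite psDE psMnE f1 expr2 psME big_ord_recl big_ord1 /=.
  by rewrite f0 mul0r mulr0 addr0 mul0rn addr0.
by elim: m => [|m IH]; [rewrite /= psXME | apply: step IH; apply: pi_inv_ser_c0].
Qed.

Definition quad_ser (R : comPzRingType) m : ps R := psX + psX ^+ 2 *+ 2 ^ m.

Lemma quad_ser_c0 R m : quad_ser R m 0%N = 0.
Proof. by rewrite /quad_ser psDE psMnE psXnE mul0rn addr0. Qed.

Lemma pi_inv_serS m : pi_inv_ser m.+1 = ps_comp (quad_ser _ m) (pi_inv_ser m).
Proof.
have t0 := pi_inv_ser_c0 m.
by rewrite ps_compD ps_compMn ps_compXn // !ps_compX.
Qed.

Section Binomial.

Definition binomial_ser (a c : rat) : ps rat := fun i => gbin a i * c ^+ i.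

Lemma gbin0 a : gbin a 0 = 1.
Proof. by rewrite /gbin big_ord0 divr1. Qed.

Lemma gbinS a i : gbin a i.+1 * i.+1%:R = (a - i%:R) * gbin a i.
Proof.
rewrite /gbin big_ord_recr /= factS natrM.
have: (i.+1%:R : rat) != 0 by rewrite pnatr_eq0.
by move: i.+1%:R => c c0; rewrite invfM [c^-1 * _]mulrC !mulrA mulfVK // mulrAC mulrC mulrA.
Qed.

(** Vandermonde's identity, by induction on d: (d+1) times the sum in degree d+1
    splits as i + (d+1-i), and both halves are lowered to degree d by gbinS. *)
Lemma gbinD a b d : \sum_(i < d.+1) gbin a i * gbin b (d - i)%N = gbin (a + b) d.
Proof.
elim: d => [|d IH]; first by rewrite big_ord1 !gbin0 mulr1.
apply: (@mulIf _ (d.+1%:R : rat)); first by rewrite pnatr_eq0.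
rewrite gbinS -IH mulr_suml mulr_sumr.
transitivity (\sum_(i < d.+2) (gbin a i * i%:R * gbin b (d.+1 - i)%N
  + gbin a i * (gbin b (d.+1 - i)%N * (d.+1 - i)%N%:R))).
  apply: eq_bigr => i _; have le_i : (i <= d.+1)%N by rewrite -ltnS.
  by rewrite -[in X in _ * X = _](subnK le_i) natrD; ring.
rewrite big_split /= big_ord_recl mulr0 mul0r add0r.
rewrite [X in _ + X]big_ord_recr /= subnn mulr0 mulr0 addr0 -big_split /=.
apply: eq_bigr => i _; have le_i : (i <= d)%N by rewrite -ltnS.
rewrite /bump /= add1n subSS gbinS subSn // gbinS.
by rewrite natrB //; ring.
Qed.

Lemma binomial_serD a b c : binomial_ser a c * binomial_ser b c = binomial_ser (a + b) c.
Proof.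
apply: psP => d; rewrite psME /binomial_ser -gbinD mulr_suml; apply: eq_bigr => i _.
have le_i : (i <= d)%N by rewrite -ltnS.
by rewrite mulrACA -exprD subnKC.
Qed.

Lemma binomial_ser1 c : binomial_ser 1 c = 1 + psC c * psX.
Proof.
apply: psP => -[|[|d]]; rewrite psDE psCME /binomial_ser.
- by rewrite gbin0 mul1r mulr0 addr0.
- by rewrite /gbin big_ord1 subr0 divr1 mul1r ps1E mulr1 add0r.
- by rewrite /gbin !big_ord_recl /= subrr mul0r mulr0 !mul0r mulr0 addr0.
Qed.

Lemma binomial_ser_exp m c : binomial_ser (2%:R ^- m) c ^+ (2 ^ m) = 1 + psC c * psX.
Proof.
elim: m => [|m IH]; first by rewrite expr0 invr1 binomial_ser1.
rewrite expnS exprM expr2 binomial_serD -IH; congr (binomial_ser _ _ ^+ _).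
by rewrite exprS invfM -mulrDl -div1r -mulrDl divff ?mul1r.
Qed.

End Binomial.

(** The series pi_(m+1) over the rationals: r is the 2^m-th root of 1 + 2^(m+1) t and
    h = (1 + r) / 2 is the series that is inverted in its definition. *)
Section PiSeries.
Variable m : nat.

Let r : ps rat := root_ser m.+1.
Let p : ps rat := pi_rat_ser m.+1.
Let h : ps rat := fun j => (ps_one rat j + r j) / 2%:R.

Let r0 : r 0%N = 1.
Proof. by rewrite /r /root_ser gbin0 mulr1. Qed.

Let h0 : h 0%N = 1.
Proof. by rewrite /h r0. Qed.

Let pE : p = 1 - (ps_inv h : ps rat).
Proof. by []. Qed.

Let p0 : p 0%N = 0.
Proof.
rewrite pE psDE psNE; have := congr1 (@^~ 0%N) (ps_mulV h0).
by rewrite psM_c0 h0 mulr1 => ->; rewrite subrr.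
Qed.

(** Since pi_(m+1) = 1 - 1 / h, the series s / (1 - s) takes the value h - 1 at it, so
    that (1 + s) / (1 - s) takes the value r. *)
Let pi_inv_ser_p j :
  1 + ps_comp (ps_map (intr : {rmorphism int -> rat}) (pi_inv_ser j)) p *+ 2 ^ j.+1 = r ^+ (2 ^ j).
Proof.
elim: j => [|j IH].
  rewrite /pi_inv_ser rmorphM /= ps_mapX ps_map_geom ps_compM // ps_compX //.
  have -> : ps_comp (ps_geom rat) p = h.
    have H : ps_comp (ps_geom rat) p * (ps_inv h : ps rat) = 1.
      have -> : (ps_inv h : ps rat) = ps_comp (1 - psX) p.
        by rewrite -mulN1r ps_compD ps_comp1 ps_compM // ps_compX //
          (_ : -1 = psC (-1)) ?ps_compC ?rmorphN1 // mulN1r pE opprB addrC subrK.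
      by rewrite -ps_compM // ps_geomP ps_comp1.
    by rewrite -[LHS]mulr1 -(ps_mulV h0) mulrA H mul1r.
  rewrite pE mulrBl mul1r ps_mulV //.
  apply: psP => d; rewrite psDE psMnE psDE psNE /h -[X in _ = X]/(r d) ps1E /ps_one.
  by rewrite expn1; field.
rewrite [in RHS]expnSr exprM -IH /= rmorphD rmorphMn rmorphXn /=.
rewrite ps_compD ps_compMn ps_compXn //; set u := ps_comp _ _.
by move: u => u; rewrite !expnS; move: (2 ^ j)%N => N; ring.
Qed.

Lemma pi_inv_ser_pi_rat :
  ps_comp (ps_map (intr : {rmorphism int -> rat}) (pi_inv_ser m)) (pi_rat_ser m.+1) = psX.
Proof.
have := pi_inv_ser_p m; rewrite /r -[root_ser m.+1]/(binomial_ser _ _) binomial_ser_exp => /addrI e.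
apply: psP => d; have := congr1 (@^~ d) e; rewrite psMnE psCME -natrX mulr_natl => /eqP.
by rewrite eqr_pMn2r ?expn_gt0 // => /eqP.
Qed.

(** pi_(m+1) is the inverse of an integral series with linear coefficient 1, hence is
    integral, so that no information is lost in taking numerators. *)
Lemma pi_serE d : (pi_ser m.+1 d)%:~R = pi_rat_ser m.+1 d :> rat.
Proof.
rewrite /pi_ser; apply: numqK; move: d.
pose T := ps_map (intr : {rmorphism int -> rat}) (pi_inv_ser m).
have T1 : T 1%N = 1 by rewrite /T /ps_map pi_inv_ser_c1.
(* the relation says that its first argument lies in the subring of integers *)
apply: (@ps_comp_rel _ _ (fun x _ : rat => x \is a Num.int) _ _ _ _ T p T p) => //.
- by move=> x _ y _; apply: rpredB.
- by move=> x _ y _; apply: rpredM.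
- by move=> i; apply: intr_int.
- by move=> d; rewrite pi_inv_ser_pi_rat; apply: rpred_nat.
Qed.

Lemma pi_ser_c0 : pi_ser m.+1 0%N = 0.
Proof. by apply: (@intr_inj rat); rewrite pi_serE; apply: p0. Qed.

Lemma pi_inv_ser_pi : ps_comp (pi_inv_ser m) (pi_ser m.+1) = psX.
Proof.
have H : injective (ps_map (intr : {rmorphism int -> rat})).
  by move=> f g /(congr1 (fun f => f _))/= e; apply: psP => d; apply: (@intr_inj rat); apply: (e d).
apply: H; rewrite ps_map_comp ps_mapX -pi_inv_ser_pi_rat; congr ps_comp.
by apply: psP => d; apply: pi_serE.
Qed.

End PiSeries.

(** If p' inverts q o F and p inverts F, then q o F takes the same value q at p and
    at p' o q. *)
Lemma ps_comp_inv_factor (R : comPzRingType) (F q p p' : ps R) :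
    F 0%N = 0 -> q 0%N = 0 -> p 0%N = 0 -> p' 0%N = 0 -> ps_comp q F 1%N = 1 ->
    ps_comp F p = psX -> ps_comp (ps_comp q F) p' = psX ->
  p = ps_comp p' q.
Proof.
move=> F0 q0 p0 p'0 F1 Fp qFp'; apply: (ps_comp_inj F1 p0); first by rewrite ps_comp_c0.
by rewrite -(ps_compA _ p'0 q0) qFp' ps_compX // (ps_compA q F0 p0) Fp ps_compXr.
Qed.

(** The identity pi_n(t) = pi_(n+1)(t + 2^(n-1) t^2), which is the source of the
    formula: it holds because the argument of the square root becomes a square,
    1 + 2^(n+1) (t + 2^(n-1) t^2) = (1 + 2^n t)^2. *)
Lemma pi_ser_rec m : pi_ser m.+1 = ps_comp (pi_ser m.+2) (quad_ser int m).
Proof.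
apply: (ps_comp_inv_factor (pi_inv_ser_c0 m) (quad_ser_c0 int m) (pi_ser_c0 m) (pi_ser_c0 m.+1)).
- by rewrite -pi_inv_serS pi_inv_ser_c1.
- exact: pi_inv_ser_pi.
- by rewrite -pi_inv_serS pi_inv_ser_pi.
Qed.

(** The binomial coefficients of the final formula come from
    (t + 2^m t^2)^k = t^k (1 + 2^m t)^k. *)
Lemma quad_ser_exp (R : comPzRingType) m k d : (k <= d)%N ->
  (quad_ser R m ^+ k) d = 'C(k, d - k)%:R * 2%:R ^+ (m * (d - k)).
Proof.
move=> le_kd; have -> : quad_ser R m = psX * (1 + psX *+ 2 ^ m).
  by rewrite /quad_ser mulrDr mulr1 mulrnAr -expr2.
rewrite exprMn psXnME le_kd exprDn ps_sumE; set e := (d - k)%N.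
have coef i : (1 ^+ (k - i) * (psX *+ 2 ^ m) ^+ i *+ 'C(k, i)) e =
    ('C(k, i)%:R * 2%:R ^+ (m * i)) *+ (e == i) :> R.
  rewrite expr1n mul1r (exprMn_n psX) !psMnE psXnE -natrX -natrM -!mulrnA expnM.
  by congr (1 *+ _); rewrite mulnC [X in (X * _)%N]mulnC.
under eq_bigr => i _ do rewrite coef.
have [le_ek|lt_ke] := leqP e k.
  rewrite (bigD1 (Ordinal (le_ek : (e < k.+1)%N))) //= eqxx big1 ?addr0 // => i ne_i.
  by rewrite (_ : (e == i) = false) //; apply: contraNF ne_i => /eqP ei; apply/eqP/val_inj.
rewrite bin_small // mul0r big1 // => i _.
by rewrite gtn_eqF // (leq_trans _ lt_ke) // ltnS -ltnS.
Qed.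

(** * One-dimensional forms and diagonalization *)
Section Lines.
Variable K : fieldType.
Implicit Types (q : qform K) (a b : K).

Definition icl (q : qform K) : isoclass K := \pi_(isoclass K) q.
Definition line (a : K) : isoclass K := icl (qline a).

Lemma icl_eq q q' : isometric q q' -> icl q = icl q'.
Proof. by move=> e; apply/isoclass_eqP. Qed.

Lemma icl_add q q' : icl (qsum q q') = icl q + icl q'.
Proof. by rewrite [RHS]icl_addE. Qed.
Lemma icl_mul q q' : icl (qtens q q') = icl q * icl q'.
Proof. by rewrite [RHS]icl_mulE. Qed.

Lemma qmx_line a (i j : 'I_(qdim (qline a))) : a != 0 -> qmx (qline a) i j = a.
Proof.
move=> a0; rewrite /qmx /= mxE (negPf a0).
by case: i j => [[|//] ?] [[|//] ?].
Qed.

Lemma qmx_lineE a : a != 0 -> qmx (qline a) = a%:M.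
Proof. by move=> a0; rewrite /qmx /= (negPf a0). Qed.

Lemma lineM a b : a != 0 -> b != 0 -> line a * line b = line (a * b).
Proof.
move=> a0 b0; rewrite -icl_mul; apply: icl_eq.
apply: (@presents_isometric _ _ _ _ _ (fun t : 'I_1 * 'I_1 => t.1)); last 2 first.
- by apply: qtens_presents; apply: presentsT.
- exact: presentsT.
- by exists (fun i => (i, i)); [case=> i j /=; rewrite [i]ord1 [j]ord1 |].
- by case=> i j [i' j'] /=; rewrite !qmx_line // mulf_neq0.
Qed.

Lemma line1 : line 1 = 1. Proof. by []. Qed.
Lemma line_sqr a : a != 0 -> line a * line a = 1.
Proof.
move=> a0; rewrite lineM // -line1; apply: icl_eq.
exists (a%:M : 'M_1), (a^-1%:M : 'M_1); split.
- by rewrite -scalar_mxM mulfV.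
- by rewrite -scalar_mxM mulVf.
- by rewrite /qmx /= tr_scalar_mx -!scalar_mxM mulf_eq0 orbb (negPf a0) oner_eq0 mulr1.
Qed.

(** The hyperbolic plane does not depend on the chosen a. *)
Lemma line_hyp a : 2%:R != 0 :> K -> a != 0 -> line a + line (- a) = 1 + line (-1).
Proof.
move=> two0 a0; rewrite -line1 -!icl_add; apply/esym/icl_eq.
(* x and y solve x + y = 1 and x - y = 1 / a, so that a (x^2 - y^2) = 1 *)
pose x := (1 + a^-1) / 2%:R; pose y := (1 - a^-1) / 2%:R.
have E1 : x * x - y * y = a^-1 by rewrite /x /y; field; rewrite two0 a0.
have E2 : a * (x * x - y * y) = 1 by rewrite E1 mulfV.
exists (block_mx (x%:M : 'M_1) y%:M y%:M (x%:M : 'M_1)).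
exists (block_mx ((a * x)%:M : 'M_1) (- (a * y))%:M (- (a * y))%:M ((a * x)%:M : 'M_1)).
split.
- rewrite mulmx_block -!scalar_mxM -!raddfD /= (scalar_mx_block 1 1 1) -E2.
  by congr block_mx; rewrite -?[RHS](raddf0 (@scalar_mx K 1)); congr (_%:M); ring.
- rewrite mulmx_block -!scalar_mxM -!raddfD /= (scalar_mx_block 1 1 1) -E2.
  by congr block_mx; rewrite -?[RHS](raddf0 (@scalar_mx K 1)); congr (_%:M); ring.
- rewrite /qmx /= !qmx_lineE ?oppr_eq0 ?oner_eq0 // tr_block_mx !tr_scalar_mx.
  rewrite !mulmx_block !mulmx0 -!scalar_mxM !addr0 !add0r -!scalar_mxM -!raddfD /= -E2.
  by congr block_mx; rewrite -?[RHS](raddf0 (@scalar_mx K 1)); congr (_%:M); ring.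
Qed.

End Lines.

Section Diagonalization.
Variable K : fieldType.
Implicit Types (q : qform K) (a : K).

Definition is_diag q := forall i j, i != j -> qmx q i j = 0.

Lemma icl_diag q : is_diag q -> icl q = \sum_i line (qmx q i i).
Proof.
suff H n (B : 'M[K]_n) sB uB : (forall i j, i != j -> B i j = 0) ->
    icl (@mkq K n B sB uB) = \sum_(i < n) line (B i i).
  move=> dq; rewrite -(H _ _ (qmx_sym q) (qmx_unit q) dq); congr icl.
  by apply: val_inj; case: q {dq} => -[].
elim: n B sB uB => [|n IH] B sB uB dB.
  rewrite big_ord0; apply: icl_eq; exists (0 : 'M_0), (0 : 'M_0).
  by split; apply/matrixP => -[].
change 'M[K]_(1 + n) in B.
have BE : B = block_mx (B ord0 ord0)%:M 0 0 (drsubmx B).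
  rewrite -[LHS]submxK; congr block_mx; apply/matrixP => i j; rewrite !mxE.
  - rewrite !ord1 eqxx; congr (B _ _); exact: val_inj.
  - by apply: dB; rewrite -val_eqE /= ord1.
  - by apply: dB; rewrite -val_eqE /= ord1.
have [uC a0] : drsubmx B \in unitmx /\ B ord0 ord0 != 0.
  have detB : \det B = B ord0 ord0 * \det (drsubmx B).
    by rewrite {1}BE; apply: etrans (det_ublock _ _ _) _; rewrite det_scalar1.
  by move: uB; rewrite unitmxE detB unitrM unitfE -unitmxE => /andP[].
have sC : (drsubmx B)^T = drsubmx B by rewrite trmx_drsub sB.
rewrite big_ord_recl; transitivity (line (B ord0 ord0) + icl (mkq sC uC)).
  rewrite -icl_add; apply: icl_eq; exists (1%:M : 'M_(1 + n)), (1%:M : 'M_(1 + n)).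
  rewrite trmx1 !mul1mx; split=> //; rewrite mulmx1 /qmx /= qmx_lineE //.
rewrite IH; last by move=> i j ij; rewrite !mxE dB // (inj_eq (@rshift_inj _ _)).
by congr (_ + _); apply: eq_bigr => i _; rewrite !mxE; congr (line (B _ _)); apply: val_inj.
Qed.

(** A nonzero symmetric matrix has a nonzero diagonal entry, after adding row and
    column j to row and column i if the diagonal is zero but B i j is not: the new
    entry is 2 (B i j). *)
Lemma mx_sym_pivot n (B : 'M[K]_n) : 2%:R != 0 :> K -> B^T = B -> B != 0 ->
  exists2 P : 'M[K]_n, P \in unitmx & exists i, (P *m B *m P^T) i i != 0.
Proof.
move=> two0 sB nzB.
have [[i Bii]|Bd] := pselect (exists i, B i i != 0).
  by exists 1%:M; [apply: unitmx1 | exists i; rewrite mul1mx trmx1 mulmx1].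
have {}Bd i : B i i = 0 by apply: contrapT => /eqP ?; apply: Bd; exists i.
have [i [j Bij]] : exists i j, B i j != 0.
  apply: contrapT => H; case/eqP: nzB; apply/matrixP => i j; rewrite mxE.
  by apply: contrapT => /eqP Bij; apply: H; exists i, j.
have ij : i != j by apply: contraNneq Bij => ->; rewrite Bd.
exists (1%:M + delta_mx i j).
  have: (1%:M + delta_mx i j) *m (1%:M - delta_mx i j) = 1%:M :> 'M[K]_n.
    rewrite mulmxDl mul1mx mulmxBr mulmx1 mul_delta_mx_0 1?eq_sym // subr0.
    by rewrite subrK.
  by case/mulmx1_unit.
exists i.
have dl (M : 'M[K]_n) u : (delta_mx i j *m M) i u = M j u.
  rewrite mxE (bigD1 j) //= mxE !eqxx mul1r big1 ?addr0 // => k /negPf kj.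
  by rewrite mxE kj andbF mul0r.
have dr (M : 'M[K]_n) u : (M *m delta_mx j i) u i = M u j.
  transitivity ((M *m delta_mx j i)^T i u); first by rewrite [RHS]mxE.
  by rewrite trmx_mul trmx_delta dl mxE.
rewrite raddfD /= trmx1 trmx_delta mulmxDl mul1mx mulmxDr mulmx1 [X in X != _]mxE.
rewrite dr [X in X + _]mxE [X in _ + X]mxE !dl !Bd addr0 add0r.
have -> : B j i = B i j by rewrite -[in RHS]sB mxE.
by rewrite -mulr2n -mulr_natl mulf_neq0.
Qed.

Lemma mx_sym_clear n (M : 'M[K]_(1 + n)) : M^T = M -> M 0 0 != 0 ->
  exists2 L, L \in unitmx & exists C : 'M[K]_n, L *m M *m L^T = block_mx (M 0 0)%:M 0 0 C.
Proof.
move=> sM a0; set a := M 0 0 in a0 *; pose c := dlsubmx M.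
have ulM : ulsubmx M = a%:M.
  apply/matrixP => u v; rewrite !ord1 !mxE eqxx mulr1n; congr (M _ _); exact: val_inj.
have urM : ursubmx M = c^T by rewrite /c trmx_dlsub sM.
exists (block_mx 1%:M 0 (- a^-1 *: c) 1%:M); first by rewrite unitmxE det_lblock !det1 mulr1 unitr1.
set D := drsubmx M; exists (D - a^-1 *: (c *m c^T)).
have -> : M = block_mx a%:M c^T c D by rewrite -[LHS]submxK ulM urM.
rewrite tr_block_mx !trmx1 trmx0 !mulmx_block.
rewrite !mul1mx !mulmx1 !mul0mx !mulmx0 !addr0 linearZ /= -!scalemxAl -!scalemxAr.
rewrite !mul_mx_scalar !mul_scalar_mx !scalerA mulNr mulVf //.
by rewrite !scaleN1r !addNr mul0mx scaler0 add0r scaleNr addrC.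
Qed.

Lemma qform_split_line n (B : 'M[K]_(1 + n)) (sB : B^T = B) (uB : B \in unitmx) :
    2%:R != 0 :> K ->
  exists a (C : 'M[K]_n) (sC : C^T = C) (uC : C \in unitmx),
    a != 0 /\ icl (mkq sB uB) = line a + icl (mkq sC uC).
Proof.
move=> two0.
have nzB : B != 0 by apply: contraTneq uB => ->; rewrite unitmxE det0 unitr0.
have [P uP [i Pii]] := mx_sym_pivot two0 sB nzB.
pose S : 'M[K]_(1 + n) := perm_mx (tperm ord0 i).
have [||L uL [C]] := @mx_sym_clear n (S *m (P *m B *m P^T) *m S^T).
- by rewrite !trmx_mul !trmxK sB !mulmxA.
- by rewrite /S tr_perm_mx -col_permE -row_permE 2!mxE tpermL.
set a := (_ *m _ *m S^T) 0 0.
have -> : L *m (S *m (P *m B *m P^T) *m S^T) *m L^T =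
    (L *m S *m P) *m B *m (L *m S *m P)^T by rewrite !trmx_mul !mulmxA.
have {uL} : L *m S *m P \in unitmx by rewrite !unitmx_mul uL uP unitmx_perm.
move: (L *m S *m P) => Q uQ QBQ.
have uN : block_mx (a%:M : 'M_1) 0 0 C \in unitmx.
  by rewrite -QBQ !unitmx_mul unitmx_tr uQ uB.
have [a0 uC] : a != 0 /\ C \in unitmx.
  by move: uN; rewrite unitmxE det_ublock det_scalar1 unitrM unitfE -unitmxE => /andP[].
have sC : C^T = C.
  have : (block_mx (a%:M : 'M_1) 0 0 C)^T = block_mx a%:M 0 0 C.
    by rewrite -QBQ !trmx_mul trmxK sB mulmxA.
  by rewrite tr_block_mx => /eq_block_mx[].
exists a, C, sC, uC; split=> //; rewrite -icl_add; apply/esym/icl_eq.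
exists Q, (invmx Q); split; first exact: mulmxV.
  exact: mulVmx.
by rewrite /qmx /= qmx_lineE.
Qed.

(** Every form is diagonalizable.  All computations in GW(K) below reduce to sums of
    one-dimensional forms by means of this lemma. *)
Lemma icl_sum_line (x : isoclass K) : 2%:R != 0 :> K ->
  exists n (a : 'I_n -> K), (forall i, a i != 0) /\ x = \sum_i line (a i).
Proof.
move=> two0; elim/isoclassW: x => q.
have [n [B [sB [uB ->]]]] : exists n (B : 'M[K]_n) sB uB, q = @mkq K n B sB uB.
  exists (qdim q), (qmx q), (qmx_sym q), (qmx_unit q).
  by apply: val_inj; case: q => -[].
rewrite -/(icl _).
elim: n B sB uB => [|n IH] B sB uB.
  exists 0%N, (fun=> 1); split; first by case.
  rewrite big_ord0; apply: icl_eq; exists (0 : 'M_0), (0 : 'M_0).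
  by split; apply/matrixP => -[].
have [a [C [sC [uC [a0 ->]]]]] := @qform_split_line n B sB uB two0.
have [m [b [b0 ->]]] := IH C sC uC.
exists m.+1, (fun i => if unlift ord0 i is Some j then b j else a); split.
  by move=> i; case: unliftP.
rewrite big_ord_recl unlift_none; congr (_ + _).
by apply: eq_bigr => i _; rewrite liftK.
Qed.

End Diagonalization.

(** * Exterior powers and the series lambda_t *)
Section ExteriorPowers.
Variable K : fieldType.
Implicit Types (a : K).

Lemma det_diag_minor n d (B : 'M[K]_n) (t t' : incr_tuple d n) :
    (forall i j, i != j -> B i j = 0) -> t != t' ->
  \det (mxsub (incr_fun t) (incr_fun t') B) = 0.
Proof.
move=> dB tt'; rewrite /determinant big1 // => s _.
have [/forallP H|] := boolP [forall i, incr_fun t i == incr_fun t' (s i)].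
  have [] := @incr_fun_perm_inj _ _ t t' 1%g s; first by move=> i; rewrite perm1; apply/eqP.
  by move=> e; rewrite e eqxx in tt'.
rewrite negb_forall => /existsP[i ne_i].
by rewrite (bigD1 i) //= mxE dB // mul0r mulr0.
Qed.

Lemma det_diag_minor_id n d (B : 'M[K]_n) (t : incr_tuple d n) :
    (forall i j, i != j -> B i j = 0) ->
  \det (mxsub (incr_fun t) (incr_fun t) B) = \prod_i B (incr_fun t i) (incr_fun t i).
Proof.
move=> dB; rewrite det_trig; first by apply: eq_bigr => i _; rewrite mxE.
apply/is_trig_mxP => i j ltij; rewrite mxE dB // (inj_eq (@incr_fun_inj _ _ t)).
by rewrite -val_eqE /= ltn_eqF.
Qed.

Lemma line_prod (I : finType) (a : I -> K) : (forall i, a i != 0) ->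
  line (\prod_i a i) = \prod_i line (a i).
Proof.
move=> a0; suff [] : line (\prod_i a i) = \prod_i line (a i) /\ \prod_i a i != 0 by [].
elim/big_rec2: _ => [|i y x _ [<- x0]]; first by rewrite oner_eq0.
by rewrite mulf_neq0 // lineM.
Qed.

(** The matrix of minors of a diagonal matrix is diagonal, so that the d-th exterior
    power of a diagonal form is the d-th elementary symmetric function of its
    entries. *)
Lemma icl_ext_sum_line n (a : 'I_n -> K) d : (forall i, a i != 0) ->
  icl_ext d (\sum_i line (a i)) =
    \sum_(t : incr_tuple d n) \prod_j line (a (incr_fun t j)).
Proof.
move=> a0; pose B : 'M[K]_n := diag_mx (\row_i a i).
have dB i j : i != j -> B i j = 0 by move=> ij; rewrite !mxE (negPf ij).
have Bii i : B i i = a i by rewrite !mxE eqxx.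
have sB : B^T = B by rewrite tr_diag_mx.
have uB : B \in unitmx.
  by rewrite unitmxE det_diag unitfE; apply/prodf_neq0 => i _; rewrite mxE.
have -> : \sum_i line (a i) = icl (mkq sB uB).
  by rewrite icl_diag //; apply: eq_bigr => i _; rewrite Bii.
rewrite icl_extE -/(icl _) icl_diag => [|i j ij]; last first.
  by rewrite [LHS]mxE det_diag_minor // (inj_eq enum_val_inj).
rewrite [RHS](reindex (fun i : 'I_#|incr_tuple d n| => enum_val i)) /=; last first.
  exact/onW_bij/enum_val_bij.
apply: eq_bigr => i _; rewrite [qmx _ i i]mxE det_diag_minor_id // line_prod.
  by apply: eq_bigr => j _; rewrite Bii.
by move=> j; rewrite Bii.
Qed.

Lemma sum_incr_tuple_sets (R : comPzRingType) d n (x : 'I_n -> R) :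
  \sum_(t : incr_tuple d n) \prod_j x (incr_fun t j) =
  \sum_(S : {set 'I_n} | #|S| == d) \prod_(i in S) x i.
Proof.
pose f (t : incr_tuple d n) : {set 'I_n} := [set incr_fun t j | j : 'I_d]%SET.
have cf t : #|f t| = d by rewrite card_imset ?card_ord //; apply: incr_fun_inj.
have f_inj : injective f.
  move=> t t' /setP H; apply: val_inj; apply: val_inj; apply: (inj_map val_inj).
  apply: (irr_sorted_eq ltn_trans ltnn (valP t) (valP t')) => y.
  have sub (u v : incr_tuple d n) : f u =i f v ->
      {subset map val (val u) <= map val (val v)}.
    move=> {}H _ /mapP[z /tnthP[i ->] ->]; apply: map_f.
    have : incr_fun u i \in f u by apply: imset_f.
    by rewrite H => /imsetP[j _]; rewrite /incr_fun => ->; apply: mem_tnth.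
  by apply/idP/idP; apply: sub.
have fE : [set S : {set 'I_n} | #|S| == d]%SET = [set f t | t : incr_tuple d n]%SET.
  apply/esym/eqP; rewrite eqEcard; apply/andP; split.
    by apply/fintype.subsetP => _ /imsetP[t _ ->]; rewrite inE cf.
  rewrite card_draws card_ord card_imset // card_sig -cardsE.
  by rewrite card_ltn_sorted_tuples.
transitivity (\sum_(S in [set f t | t : incr_tuple d n]%SET) \prod_(i in S) x i).
  rewrite big_imset /=; last by move=> t t' _ _; apply: f_inj.
  apply: eq_big => [t|t _]; first by rewrite inE.
  rewrite big_imset /=; last by move=> i j _ _; apply: incr_fun_inj.
  by apply: eq_bigl => i; rewrite inE.
by apply: eq_bigl => S; rewrite -fE inE.
Qed.

Lemma coef_prod_1X (R : comPzRingType) n (x : 'I_n -> R) d :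
  (\prod_i (1 + psC (x i) * psX)) d = \sum_(S : {set 'I_n} | #|S| == d) \prod_(i in S) x i.
Proof.
under eq_bigr => i _ do rewrite addrC.
rewrite bigA_distr /= ps_sumE [RHS]big_mkcond; apply: eq_bigr => S _ /=.
rewrite -big_mkcond /= big_split /= -rmorph_prod /=.
rewrite prodr_const psCME psXnE eq_sym.
by case: eqP; rewrite ?mulr1 ?mulr0.
Qed.

End ExteriorPowers.

(** Products of fractions f' / f and g' / g of power series, written without division. *)
Lemma ps_fracM (R : comPzRingType) (f f' g g' u v w : ps R) :
    u * f = f' -> v * g = g' -> f 0%N = 1 -> g 0%N = 1 -> w * (f * g) = f' * g' ->
  w = u * v.
Proof.
move=> uf vg f0 g0 wfg; apply: (@ps_mulIf _ (f * g)); first by rewrite psM_c0 f0 g0 mulr1.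
by rewrite wfg -uf -vg mulrACA.
Qed.

Section Lambda.
Variable K : fieldType.
Implicit Types x y : isoclass K.

Fact to_groth_nmod : nmod_morphism (@to_groth (isoclass K)).
Proof.
split=> // x y; apply/esym; apply: etrans (groth_addE _ _) _.
by rewrite /= addr0.
Qed.
Fact to_groth_monoid : monoid_morphism (@to_groth (isoclass K)).
Proof.
split=> // x y; apply/esym; apply: etrans (groth_mulE _ _) _.
by rewrite /= !mulr0 mul0r !addr0.
Qed.
HB.instance Definition _ := GRing.isNmodMorphism.Build (isoclass K) (GW K)
  (@to_groth (isoclass K)) to_groth_nmod.
HB.instance Definition _ := GRing.isMonoidMorphism.Build (isoclass K) (GW K)
  (@to_groth (isoclass K)) to_groth_monoid.

Lemma gw_repr (z : GW K) : z = to_groth (repr z).1 - to_groth (repr z).2.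
Proof.
rewrite -[LHS]reprK; case: (repr z) => a b; apply/esym.
have -> : - to_groth b = \pi_(GW K) (0, b) by exact: groth_oppE.
by apply: etrans (groth_addE _ _) _; rewrite /= addr0 add0r.
Qed.

Lemma gw_repr_sub x y : let z := to_groth x - to_groth y in
  exists r, (repr z).1 + y + r = x + (repr z).2 + r.
Proof.
have -> : to_groth x - to_groth y = \pi_(GW K) (x, y).
  have -> : - to_groth y = \pi_(GW K) (0, y) by exact: groth_oppE.
  by apply: etrans (groth_addE _ _) _; rewrite /= addr0 add0r.
exact: groth_reprP.
Qed.

(** The two series below are locked because comparing them by unfolding amounts to
    comparing matrices of minors. *)
Fact lambda_key : unit. Proof. exact: tt. Qed.

Definition icl_lambda (x : isoclass K) : ps (GW K) :=
  locked_with lambda_key (fun d => to_groth (icl_ext d x)).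

Definition gw_lambda_ps (z : GW K) : ps (GW K) := locked_with lambda_key (gw_lambda z).

Lemma gw_lambda_ps_repr z :
  gw_lambda_ps z = icl_lambda (repr z).1 * (ps_inv (icl_lambda (repr z).2) : ps (GW K)).
Proof. by rewrite /gw_lambda_ps /icl_lambda; case: lambda_key. Qed.

Hypothesis two0 : 2%:R != 0 :> K.

Lemma icl_lambda_sum_line n (a : 'I_n -> K) : (forall i, a i != 0) ->
  icl_lambda (\sum_i line (a i)) = \prod_i (1 + psC (gw_line (a i)) * psX).
Proof.
move=> a0; apply: psP => d; rewrite /icl_lambda unlock icl_ext_sum_line // rmorph_sum /=.
under eq_bigr => t _ do rewrite rmorph_prod /=.
rewrite (@sum_incr_tuple_sets _ d n (fun i => to_groth (line (a i)))).
by rewrite -coef_prod_1X.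
Qed.

(** After diagonalization both sides are products of factors 1 + <a> t. *)
Lemma icl_lambdaD x y : icl_lambda (x + y) = icl_lambda x * icl_lambda y.
Proof.
have [n [a [a0 ->]]] := icl_sum_line x two0.
have [m [b [b0 ->]]] := icl_sum_line y two0.
have [c [c0 cl cr]] : exists c : 'I_(n + m) -> K, [/\ forall i, c i != 0,
    forall i, c (lshift m i) = a i & forall i, c (rshift n i) = b i].
  exists (fun i => match split i with inl i => a i | inr j => b j end).
  by split=> i; [case: split | rewrite (unsplitK (inl _)) | rewrite (unsplitK (inr _))].
have -> : \sum_i line (a i) + \sum_i line (b i) = \sum_i line (c i).
  by rewrite big_split_ord; congr (_ + _); apply: eq_bigr => i _; rewrite (cl, cr).
apply: etrans (icl_lambda_sum_line c0) _; rewrite big_split_ord /=.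
apply/esym; apply: etrans (congr2 *%R (icl_lambda_sum_line a0) (icl_lambda_sum_line b0)) _.
apply: congr2; apply: eq_bigr => i _; first by rewrite cl.
by rewrite cr.
Qed.

Lemma icl_lambda_c0 x : icl_lambda x 0%N = 1.
Proof.
have [n [a [a0 ->]]] := icl_sum_line x two0; rewrite icl_lambda_sum_line //.
by elim/big_rec: _ => // i f _ f0; rewrite psM_c0 f0 psDE psM_c0 mulr0 addr0 ps1E mulr1.
Qed.

Lemma gw_lambda_psE x y : gw_lambda_ps (to_groth x - to_groth y) * icl_lambda y = icl_lambda x.
Proof.
have [r] := gw_repr_sub x y; set z := to_groth x - _.
move=> /(congr1 icl_lambda); rewrite !icl_lambdaD => e.
apply: (@ps_mulIf _ (icl_lambda (repr z).2 * icl_lambda r)) => /=.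
  by rewrite psM_c0 !icl_lambda_c0 mulr1.
rewrite [RHS]mulrA -e.
rewrite gw_lambda_ps_repr.
transitivity (icl_lambda (repr z).1 * icl_lambda y * icl_lambda r *
   ((ps_inv (icl_lambda (repr z).2) : ps (GW K)) * icl_lambda (repr z).2)); first by ring.
by rewrite ps_mulV ?icl_lambda_c0 // mulr1.
Qed.

Lemma gw_lambda_psD u v : gw_lambda_ps (u + v) = gw_lambda_ps u * gw_lambda_ps v.
Proof.
rewrite (gw_repr u) (gw_repr v); move: (repr u) (repr v) => [a b] [c d] /=.
have -> : to_groth a - to_groth b + (to_groth c - to_groth d) =
    to_groth (a + c) - to_groth (b + d).
  by rewrite !rmorphD /= opprD addrACA.
apply: (ps_fracM (gw_lambda_psE a b) (gw_lambda_psE c d)); rewrite ?icl_lambda_c0 //.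
by rewrite -(icl_lambdaD b d) gw_lambda_psE icl_lambdaD.
Qed.

Lemma icl_lambda0 : icl_lambda 0 = 1.
Proof.
have a0 (i : 'I_0) : (1 : K) != 0 by apply: oner_neq0.
by have := icl_lambda_sum_line a0; rewrite !big_ord0.
Qed.

Lemma gw_lambda_ps0 : gw_lambda_ps 0 = 1.
Proof. by have := gw_lambda_psE 0 0; rewrite subrr icl_lambda0 mulr1. Qed.

Lemma gw_lambda_ps_line a : a != 0 -> gw_lambda_ps (gw_line a) = 1 + psC (gw_line a) * psX.
Proof.
move=> a0; have := gw_lambda_psE (line a) 0; rewrite rmorph0 subr0 icl_lambda0 mulr1 => ->.
have a0' (i : 'I_1) : a != 0 by [].
by have := icl_lambda_sum_line a0'; rewrite !big_ord1.
Qed.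

End Lambda.

(** * Dimension and generators of the augmentation ideal *)
Section Dimension.
Variable K : fieldType.
Implicit Types (x y : isoclass K) (u v : GW K).

Definition icl_dim (x : isoclass K) : nat := qdim (repr x).

Lemma isometric_qdim (q q' : qform K) : isometric q q' -> qdim q = qdim q'.
Proof.
by case=> P [Q [PQ QP _]]; apply/eqP; rewrite eqn_leq (mulmx1_min PQ) (mulmx1_min QP).
Qed.

Lemma icl_dimE (q : qform K) : icl_dim (icl q) = qdim q.
Proof. exact/isometric_qdim/isoclass_reprP. Qed.

Lemma icl_dimD x y : icl_dim (x + y) = (icl_dim x + icl_dim y)%N.
Proof.
elim/isoclassW: x => q; elim/isoclassW: y => q'.
by rewrite -!/(icl _) -icl_add !icl_dimE.
Qed.

Lemma icl_dim_line (a : K) : icl_dim (line a) = 1%N.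
Proof. exact: icl_dimE. Qed.

Lemma icl_dim0 : icl_dim 0 = 0%N.
Proof. exact: (icl_dimE (qzero K)). Qed.

Lemma icl_dim_sum_line n (a : 'I_n -> K) : icl_dim (\sum_i line (a i)) = n.
Proof.
elim: n a => [|n IH] a; first by rewrite big_ord0 icl_dim0.
by rewrite big_ord_recl icl_dimD icl_dim_line IH.
Qed.

Lemma gw_dimE x y : gw_dim (to_groth x - to_groth y) = (icl_dim x)%:Z - (icl_dim y)%:Z.
Proof.
have [r] := gw_repr_sub x y; set z := to_groth x - _ => /(congr1 icl_dim).
rewrite !icl_dimD /gw_dim -!/(icl_dim _) => /addIn e.
by apply/eqP; rewrite subr_eq addrAC eq_sym subr_eq -!PoszD eqz_nat -e.
Qed.

Lemma gw_dimB u v : gw_dim (u - v) = gw_dim u - gw_dim v.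
Proof.
rewrite (gw_repr u) (gw_repr v) !gw_dimE; move: (repr u) (repr v) => [a b] [c d] /=.
rewrite opprD opprK (addrC (- _)) addrACA -opprD -!rmorphD gw_dimE !icl_dimD; lia.
Qed.

Lemma fundIB u v : fundI u -> fundI v -> fundI (u - v).
Proof. by rewrite /fundI /= gw_dimB => -> ->. Qed.

Lemma fundI_pf1 (a : K) : fundI (pf1 a).
Proof.
have -> : pf1 a = to_groth 1 - to_groth (line a) by [].
by rewrite /fundI /= gw_dimE -line1 !icl_dim_line subrr.
Qed.

Hypothesis two0 : 2%:R != 0 :> K.

Lemma gw_ind (P : GW K -> Prop) : P 0 -> (forall u v, P u -> P v -> P (u - v)) ->
  (forall a, a != 0 -> P (gw_line a)) -> forall u, P u.
Proof.
move=> P0 PB Pl u; rewrite (gw_repr u); move: (repr u) => [x y] /=.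
suff H z : P (to_groth z) by apply: (PB).
have [n [a [a0 ->]]] := icl_sum_line z two0; rewrite rmorph_sum /=.
elim/big_rec: _ => // i w _ Pw.
by rewrite -[w]opprK; apply: (PB); [apply: Pl | rewrite -sub0r; apply: (PB)].
Qed.

(** A difference of two diagonal forms of the same length is a sum of terms
    <a> - <b> = <<b>> - <<a>>. *)
Lemma fundI_ind (P : GW K -> Prop) : P 0 -> (forall u v, P u -> P v -> P (u - v)) ->
  (forall a, a != 0 -> P (pf1 a)) -> forall u, fundI u -> P u.
Proof.
move=> P0 PB Pl u; rewrite (gw_repr u); move: (repr u) => [x y] /=.
rewrite /fundI /= gw_dimE.
have [n [a [a0 ->]]] := icl_sum_line x two0.
have [m [b [b0 ->]]] := icl_sum_line y two0.
rewrite !icl_dim_sum_line => /eqP; rewrite subr_eq0 => /eqP[nm].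
case: m / nm b b0 => b b0; rewrite !rmorph_sum /= -sumrB.
elim/big_rec: _ => // i w _ Pw.
rewrite -[w]opprK; apply: (PB); last by rewrite -sub0r; apply: (PB).
have -> : to_groth (line (a i)) - to_groth (line (b i)) = pf1 (b i) - pf1 (a i).
  by rewrite /pf1 opprB [RHS]addrC subrKA.
by apply: (PB); apply: Pl.
Qed.

End Dimension.

(** * Powers of an ideal *)
Section IdealPow.
Variables (R : comPzRingType) (I : set R).
Hypothesis IN : forall x, I x -> I (- x).

Lemma ideal_pow0 n : ideal_pow I n 0.
Proof. by case: n => //= n; exists [::]; rewrite big_nil. Qed.

Lemma ideal_powB n x y : ideal_pow I n x -> ideal_pow I n y -> ideal_pow I n (x - y).
Proof.
case: n => //= n [s [sI ->]] [t [tI ->]].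
exists (s ++ [seq (- p.1, p.2) | p <- t]); split.
  move=> p; rewrite mem_cat => /orP[/sI//|/mapP[q /tI[Iq Jq] ->]] /=.
  by split=> //; apply: IN.
rewrite big_cat big_map /= -sumrN; congr (_ + _).
by apply: eq_bigr => p _; rewrite mulNr.
Qed.

Lemma ideal_powN n x : ideal_pow I n x -> ideal_pow I n (- x).
Proof. by move=> Ix; rewrite -sub0r; apply: ideal_powB => //; apply: ideal_pow0. Qed.

Lemma ideal_powD n x y : ideal_pow I n x -> ideal_pow I n y -> ideal_pow I n (x + y).
Proof. by move=> Ix Iy; rewrite -[y]opprK; apply: ideal_powB => //; apply: ideal_powN. Qed.

Lemma ideal_pow_sum n J (r : seq J) (P : pred J) (F : J -> R) :
  (forall j, P j -> ideal_pow I n (F j)) -> ideal_pow I n (\sum_(j <- r | P j) F j).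
Proof. by move=> IF; elim/big_ind: _ => //; [apply: ideal_pow0 | apply: ideal_powD]. Qed.

Lemma ideal_powMn n x m : ideal_pow I n x -> ideal_pow I n (x *+ m).
Proof.
move=> Ix; elim: m => [|m IH]; first exact: ideal_pow0.
by rewrite mulrS; apply: ideal_powD.
Qed.

Lemma ideal_powS n x y : I x -> ideal_pow I n y -> ideal_pow I n.+1 (x * y).
Proof.
move=> Ix Iy; exists [:: (x, y)]; rewrite big_seq1; split=> // p.
by rewrite inE => /eqP ->.
Qed.

Lemma ideal_powMl n r x : ideal_pow I n x -> ideal_pow I n (r * x).
Proof.
elim: n x => //= n IH x [s [sI ->]]; rewrite mulr_sumr big_seq.
apply: (@ideal_pow_sum n.+1) => p /sI[Ip Jp]; rewrite mulrCA.
by apply: ideal_powS => //; apply: IH.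
Qed.

Lemma ideal_powM m n x y :
  ideal_pow I m x -> ideal_pow I n y -> ideal_pow I (m + n) (x * y).
Proof.
elim: m x => [|m IH] x; first by move=> _; apply: ideal_powMl.
move=> [s [sI ->]] Iy; rewrite mulr_suml big_seq.
apply: (@ideal_pow_sum (m + n).+1) => p /sI[Ip Jp]; rewrite -mulrA.
by apply: ideal_powS => //; apply: IH.
Qed.

Lemma ideal_pow_addl m n x : ideal_pow I (m + n) x -> ideal_pow I n x.
Proof.
elim: m x => // m IH x /= [s [sI ->]]; rewrite big_seq.
by apply: ideal_pow_sum => p /sI[_ /IH]; apply: ideal_powMl.
Qed.

End IdealPow.

(** * Pfister forms *)

(** The computations of lambda_t on Pfister forms take place in the power series ring
    and only use a few relations between the forms; they are stated over an
    arbitrary commutative ring. *)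
Section PfisterSeries.
Variable R : comPzRingType.

(** Here c is <a>, u is lambda_t(<<a>>) and G is 1 / (1 - t): the defining relation
    lambda_t(<<a>>) lambda_t(<a>) = lambda_t(<1>) is solved for u, using that
    (1 - c) (1 + c t) = (1 - c) (1 - t). *)
Lemma lambda_pf1_identity (c : R) (G u : ps R) : c * c = 1 -> G * (1 - psX) = 1 ->
  u * (1 + psC c * psX) = 1 + psX -> u = 1 + psC (1 - c) * (psX * G).
Proof.
move=> c2 G1 e; apply: (@ps_mulIf _ (1 + psC c * psX)).
  by rewrite psDE psCME mulr0 addr0.
rewrite e rmorphB rmorph1 /=.
have : psC c * psC c = 1 by rewrite -rmorphM c2 rmorph1.
move: (psC c) => C C2.
have E : (1 - C) * (1 + C * psX) = (1 - C) * (1 - psX).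
  transitivity (1 - C + C * psX - (C * C) * psX); first by ring.
  by rewrite C2; ring.
transitivity (1 + C * psX + (1 - C) * (1 - psX) * G * psX); last by rewrite -E; ring.
transitivity (1 + C * psX + (1 - C) * (G * (1 - psX)) * psX); last by ring.
by rewrite G1; ring.
Qed.

(** Here a, b, c are the Pfister forms <<x>> p, <<y>> p, <<x y>> p, where p is a Pfister form
    with p^2 = N p, and f = a + b - c is <<x, y>> p.  Expanding, and using a b = N f and
    c f = 0, (1 + a T) (1 + b T) = (1 + c T) (1 + f (T + N T^2)). *)
Lemma lambda_pfister_identity (a b c : R) (N : nat) (T u : ps R) (f := a + b - c) :
    a * b = f *+ N -> c * f = 0 -> T 0%N = 0 ->
    u * (1 + psC c * T) = (1 + psC a * T) * (1 + psC b * T) ->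
  u = 1 + psC f * (T + T ^+ 2 *+ N).
Proof.
move=> ab cf T0 e; apply: (@ps_mulIf _ (1 + psC c * T)).
  by rewrite psDE psCME T0 mulr0 addr0.
rewrite e.
have ab' : psC a * psC b = psC f *+ N by rewrite -rmorphM ab rmorphMn.
have cf' : psC c * psC f = 0 by rewrite -rmorphM cf rmorph0.
have fE : psC f = psC a + psC b - psC c by rewrite /f rmorphB rmorphD.
transitivity (1 + (psC a + psC b) * T + (psC a * psC b) * T ^+ 2); first by ring.
have -> : psC a + psC b = psC f + psC c by rewrite fE subrK.
transitivity (1 + psC f * (T + T ^+ 2 *+ N) + psC c * T + psC c * psC f * (T + T ^+ 2 *+ N) * T).
  by rewrite ab' cf' mul0r mul0r addr0; ring.
by ring.
Qed.

End PfisterSeries.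

Section PfisterForms.
Variable K : fieldType.
Implicit Types (a b : K) (s : seq K).

Definition nonzero (s : seq K) : bool := all (fun a => a != 0) s.

Lemma pfister_cons a s : pfister (a :: s) = pf1 a * pfister s.
Proof. by rewrite /pfister big_cons. Qed.

Lemma pfister_pow n s : size s = n -> fundI_pow n (pfister s).
Proof.
elim: n s => [|n IH] [|a s] // [sz]; rewrite pfister_cons.
by apply: ideal_powS; [apply: fundI_pf1 | apply: IH].
Qed.

Lemma gw_line1 : gw_line (1 : K) = 1. Proof. by []. Qed.

Lemma gw_lineM a b : a != 0 -> b != 0 -> gw_line (a * b) = gw_line a * gw_line b.
Proof. by move=> a0 b0; rewrite -[gw_line (a * b)]/(to_groth (line (a * b))) -lineM // rmorphM. Qed.

Lemma gw_line_sqr a : a != 0 -> gw_line a * gw_line a = 1.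
Proof. by move=> a0; rewrite -[gw_line a]/(to_groth (line a)) -rmorphM line_sqr. Qed.

Lemma pf1_sqr a : a != 0 -> pf1 a * pf1 a = pf1 a *+ 2.
Proof.
move=> /gw_line_sqr; rewrite /pf1; move: (gw_line a) => x x2.
transitivity (1 - x - x + x * x); first by ring.
by rewrite x2; ring.
Qed.

Lemma pfister_sqr s : nonzero s -> pfister s * pfister s = pfister s *+ 2 ^ size s.
Proof.
elim: s => [|a s IH]; first by rewrite /pfister big_nil mul1r.
case/andP=> a0 s0; rewrite pfister_cons mulrACA pf1_sqr // IH // mulrnAl mulrnAr -mulrnA.
by rewrite expnSr.
Qed.

(** The relation <<a, b>> = <<a>> + <<b>> - <<a b>> lets statements about (n+1)-fold Pfister
    forms be deduced from n-fold ones by additivity alone. *)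
Lemma pf1M a b : a != 0 -> b != 0 -> pf1 a * pf1 b = pf1 a + pf1 b - pf1 (a * b).
Proof. by move=> a0 b0; rewrite /pf1 gw_lineM //; ring. Qed.

(** The form <<a, b>> represents a b, in the sense that <a b> <<a, b>> = <<a, b>>. *)
Lemma pf1M_ann a b : a != 0 -> b != 0 -> pf1 (a * b) * (pf1 a * pf1 b) = 0.
Proof.
move=> a0 b0; have := gw_line_sqr a0; have := gw_line_sqr b0.
rewrite /pf1 gw_lineM //; move: (gw_line a) (gw_line b) => x y y2 x2.
transitivity (1 - x - y + (x * x) * y + x * (y * y) - (x * x) * (y * y)); first by ring.
by rewrite x2 y2; ring.
Qed.

Hypothesis two0 : 2%:R != 0 :> K.

(** Multiplication by 2 and by <<-1>> differ by the hyperbolic plane <1> + <-1>, which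
    kills every <<a>> because it absorbs <a>. *)
Lemma pf1_2 a : a != 0 -> pf1 a *+ 2 = pf1 (-1) * pf1 a.
Proof.
move=> a0; have := congr1 (@to_groth _) (line_hyp two0 a0).
rewrite rmorphD [to_groth (1 + _)]rmorphD rmorph1 /= => e.
have {e} : gw_line a + gw_line (-1 * a) = 1 + gw_line (-1) by rewrite mulN1r; exact: e.
rewrite gw_lineM ?oppr_eq0 ?oner_neq0 // /pf1; move: (gw_line a) (gw_line (-1)) => x y e.
transitivity (1 - x - y + ((1 + y) - x)); first by ring.
by rewrite -e; ring.
Qed.

(** For n >= 1, the n-th power of the augmentation ideal is additively generated by
    the n-fold Pfister forms; the remaining scalars are absorbed by
    <<a>> <b> = <<a b>> - <<b>>.  This is stated as an induction principle. *)
Lemma fundI_pow_ind n (P : GW K -> Prop) :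
    P 0 -> (forall u v, P u -> P v -> P (u - v)) ->
    (forall s, size s = n.+1 -> nonzero s -> P (pfister s)) ->
  forall u, fundI_pow n.+1 u -> P u.
Proof.
elim: n P => [|n IH] P P0 PB Ps u.
  have Ppf a : a != 0 -> P (pf1 a).
    by move=> a0; have := Ps [:: a]; rewrite /pfister big_seq1 /nonzero /= a0; apply.
  case=> s [sI ->]; rewrite big_seq; elim/big_rec: _ => // -[x y] w /sI[/= Ix _] Pw.
  rewrite -[w]opprK; apply: (PB); last by rewrite -sub0r; apply: (PB).
  move: x Ix {s sI w Pw}; apply: (fundI_ind two0); first by rewrite mul0r.
    by move=> x x' Px Px'; rewrite mulrBl; apply: (PB).
  move=> a a0; move: y; apply: (gw_ind two0); first by rewrite mulr0.
    by move=> y y' Py Py'; rewrite mulrBr; apply: (PB).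
  move=> b b0; have -> : pf1 a * gw_line b = pf1 (a * b) - pf1 b.
    by rewrite /pf1 gw_lineM //; ring.
  by apply: (PB); apply: Ppf => //; apply: mulf_neq0.
case=> s [sI ->]; rewrite big_seq; elim/big_rec: _ => // -[x y] w /sI[/= Ix Iy] Pw.
rewrite -[w]opprK; apply: (PB); last by rewrite -sub0r; apply: (PB).
move: x Ix {s sI w Pw}; apply: (fundI_ind two0); first by rewrite mul0r.
  by move=> x x' Px Px'; rewrite mulrBl; apply: (PB).
move=> a a0; move: y Iy; apply: IH; first by rewrite mulr0.
  by move=> y y' Py Py'; rewrite mulrBr; apply: (PB).
move=> s sz s0; rewrite -pfister_cons; apply: Ps; first by rewrite /= sz.
by rewrite /nonzero /= a0.
Qed.

Lemma fundIN u : @fundI K u -> fundI (- u).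
Proof.
move=> Iu; rewrite -sub0r; apply: fundIB => //.
by rewrite -(subrr (pf1 (1 : K))); apply: fundIB; apply: fundI_pf1.
Qed.

Lemma fundI_pow_2 n (u : GW K) : fundI_pow n.+1 u -> u *+ 2 = pf1 (-1) * u.
Proof.
move: u; apply: (@fundI_pow_ind n (fun u => u *+ 2 = pf1 (-1) * u)); first by rewrite mul0rn mulr0.
  by move=> u v eu ev; rewrite mulrnBl eu ev mulrBr.
case=> // a s _ /andP[a0 _]; rewrite pfister_cons mulrA -pf1_2 //.
by rewrite mulrnAl.
Qed.

Lemma fundI_pow_2X n m (u : GW K) : fundI_pow n.+1 u -> u *+ 2 ^ m = pf1 (-1) ^+ m * u.
Proof.
move=> Iu; elim: m => [|m IH]; first by rewrite mul1r.
rewrite expnS mulnC mulrnA IH exprS -mulrA -mulrnAr (fundI_pow_2 Iu).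
by rewrite mulrCA.
Qed.

Definition ps_int (R : comPzRingType) (f : ps int) : ps R :=
  ps_map (intr : {rmorphism int -> R}) f.

(** On n-fold Pfister forms lambda_s(p) = 1 + p T(s), where T is the inverse of pi_n. The
    recursion T + 2^(n-1) T^2 in the definition of these series is exactly what passing
    from n-fold to (n+1)-fold forms requires. *)
Lemma gw_lambda_ps_pfister n s : size s = n.+1 -> nonzero s ->
  gw_lambda_ps (pfister s) = 1 + psC (pfister s) * ps_int (GW K) (pi_inv_ser n).
Proof.
elim: n s => [|n IH] [|a s] //.
  case: s => // _ /andP[a0 _]; rewrite /pfister big_seq1 /ps_int /pi_inv_ser.
  rewrite rmorphM /= ps_mapX ps_map_geom.
  apply: lambda_pf1_identity; [exact: gw_line_sqr | exact: ps_geomP |].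
  rewrite -gw_lambda_ps_line // -gw_lambda_psD // /pf1 subrK -gw_line1.
  rewrite gw_lambda_ps_line ?oner_neq0 //.
  by rewrite gw_line1 rmorph1 mul1r.
case: s => [//|b s] [sz] /and3P[a0 b0 s0].
pose pf c := pfister (c :: s).
have pfE : pfister [:: a, b & s] = pf a + pf b - pf (a * b).
  by rewrite /pf !pfister_cons mulrA pf1M // mulrBl mulrDl.
have szc c : size (c :: s) = n.+1 by rewrite /= sz.
have nzc c : c != 0 -> nonzero (c :: s) by move=> c0; rewrite /nonzero /= c0.
rewrite pfE.
have -> : ps_int (GW K) (pi_inv_ser n.+1) =
    ps_int (GW K) (pi_inv_ser n) + ps_int (GW K) (pi_inv_ser n) ^+ 2 *+ 2 ^ n.
  by rewrite /ps_int /= rmorphD rmorphMn rmorphXn.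
apply: lambda_pfister_identity.
- rewrite -pfE /pf !pfister_cons mulrACA pfister_sqr // mulrnAr mulrA; congr (_ *+ 2 ^ _).
  by case: sz.
- by rewrite -pfE /pf !pfister_cons [pf1 a * _]mulrA mulrACA pf1M_ann // mul0r.
- by rewrite /ps_int /ps_map pi_inv_ser_c0.
have ab0 : a * b != 0 by apply: mulf_neq0.
rewrite -(IH _ (szc a) (nzc _ a0)) -(IH _ (szc b) (nzc _ b0)) -(IH _ (szc (a * b)) (nzc _ ab0)).
by apply: etrans (esym (gw_lambda_psD two0 _ _)) _; rewrite subrK; apply: gw_lambda_psD.
Qed.

End PfisterForms.

(** * The operations pi_n^d on the powers of the augmentation ideal *)

(** The series whose coefficient in degree d lies in I^(n d) form a ring that is closed
    under the inverses that exist, so it suffices to look at generators. *)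
Section GradedSeries.
Variables (R : comPzRingType) (I : set R) (n : nat).
Hypothesis IN : forall x, I x -> I (- x).

Definition graded (f : ps R) : Prop := forall d, ideal_pow I (n * d) (f d).

Lemma graded1 : graded 1.
Proof.
case=> [|d]; last by rewrite ps1E; apply: ideal_pow0.
by rewrite muln0.
Qed.

Lemma gradedB f g : graded f -> graded g -> graded (f - g).
Proof. by move=> If Ig d; rewrite psDE psNE; apply: ideal_powB. Qed.

Lemma gradedM f g : graded f -> graded g -> graded (f * g).
Proof.
move=> If Ig d; rewrite psME; apply: ideal_pow_sum => // i _.
have le_id : (i <= d)%N by rewrite -ltnS.
by rewrite -{1}(subnKC le_id) mulnDr; apply: ideal_powM.
Qed.

Lemma graded_inv f : graded f -> graded (ps_inv f : ps R).
Proof.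
move=> If d; rewrite /ps_inv; apply: ideal_pow_sum => // m _; rewrite ps_expE.
suff: graded ((1 - f) ^+ m) by apply.
elim: {m}(m : nat) => [|m IH]; first exact: graded1.
by rewrite exprS; apply: gradedM => //; apply: gradedB => //; apply: graded1.
Qed.

Lemma graded_div f g h : graded f -> graded g -> g 0%N = 1 -> h * g = f -> graded h.
Proof.
move=> If Ig g0 hg; suff -> : h = f * (ps_inv g : ps R).
  by apply: gradedM => //; apply: graded_inv.
by apply: (ps_mulIf g0); rewrite /= -mulrA ps_mulV // mulr1.
Qed.

Lemma graded_1CX c : ideal_pow I n c -> graded (1 + psC c * psX).
Proof.
move=> Ic; case=> [|[|d]].
- by rewrite muln0.
- by rewrite muln1 psDE psCME ps1E add0r mulr1.
- by rewrite psDE psCME ps1E add0r mulr0; apply: ideal_pow0.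
Qed.

End GradedSeries.

(** Since pi_(m+1) inverts the series in gw_lambda_ps_pfister, the generating series of the
    operations pi_(m+1)^d takes the value 1 + p t at a Pfister form p. *)
Lemma ps_comp_pfister (R : comPzRingType) m (f : ps R) (c : R) :
    f = 1 + psC c * ps_int R (pi_inv_ser m) ->
  ps_comp f (ps_int R (pi_ser m.+1)) = 1 + psC c * psX.
Proof.
move=> ->; have p0 : ps_int R (pi_ser m.+1) 0%N = 0.
  by rewrite /ps_int /ps_map pi_ser_c0.
rewrite ps_compD ps_comp1 ps_compM // ps_compC; congr (1 + _ * _).
by rewrite /ps_int -ps_map_comp pi_inv_ser_pi ps_mapX.
Qed.

Lemma ps_comp_pi_rec (R : comPzRingType) m (f : ps R) d :
  ps_comp f (ps_int R (pi_ser m.+1)) d =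
  \sum_(k < d.+1) ps_comp f (ps_int R (pi_ser m.+2)) k *
     ('C(k, d - k)%:R * 2%:R ^+ (m * (d - k))).
Proof.
have -> : ps_int R (pi_ser m.+1) = ps_comp (ps_int R (pi_ser m.+2)) (quad_ser R m).
  rewrite pi_ser_rec /ps_int ps_map_comp; congr ps_comp.
  by rewrite /quad_ser rmorphD rmorphMn rmorphXn /= ps_mapX.
rewrite -ps_compA ?quad_ser_c0 //; last by rewrite /ps_int /ps_map pi_ser_c0.
by apply: eq_bigr => k _; rewrite quad_ser_exp // -ltnS.
Qed.

Section PiOperations.
Variable K : fieldType.
Hypothesis two0 : 2%:R != 0 :> K.
Implicit Types (u v : GW K).

Lemma pi_opE n d u : pi_op n d u = ps_comp (gw_lambda_ps u) (ps_int (GW K) (pi_ser n)) d.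
Proof.
apply: eq_bigr => i _; rewrite ps_expE /ps_int -rmorphXn /ps_map mulrzr.
by rewrite /gw_lambda_ps; case: lambda_key.
Qed.

Lemma pi_op_rec m d u : pi_op m.+1 d u =
  \sum_(k < d.+1) pi_op m.+2 k u * ('C(k, d - k)%:R * 2%:R ^+ (m * (d - k))).
Proof. by rewrite pi_opE ps_comp_pi_rec; apply: eq_bigr => k _; rewrite pi_opE. Qed.

Definition pi_series n u : ps (GW K) := ps_comp (gw_lambda_ps u) (ps_int (GW K) (pi_ser n.+1)).

Lemma pi_seriesD n u v : pi_series n (u + v) = pi_series n u * pi_series n v.
Proof.
by rewrite /pi_series (gw_lambda_psD two0); apply: ps_compM; rewrite /ps_int /ps_map pi_ser_c0.
Qed.

Lemma pi_series0 n : pi_series n 0 = 1.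
Proof. by rewrite /pi_series gw_lambda_ps0 // ps_comp1. Qed.

Lemma pi_series_pfister n s : size s = n.+1 -> nonzero s ->
  pi_series n (pfister s) = 1 + psC (pfister s) * psX.
Proof. by move=> sz s0; apply: ps_comp_pfister; apply: gw_lambda_ps_pfister. Qed.

Lemma gw_lambda_ps_c0 u : gw_lambda_ps u 0%N = 1.
Proof.
rewrite (gw_repr u); have := congr1 (@^~ 0%N) (gw_lambda_psE two0 (repr u).1 (repr u).2).
by rewrite psM_c0 !icl_lambda_c0 // mulr1.
Qed.

Lemma pi_series_c0 n u : pi_series n u 0%N = 1.
Proof. by rewrite /pi_series ps_comp_c0 gw_lambda_ps_c0. Qed.

(** The generating series of pi_n^d is multiplicative in u and equals 1 + p t on a
    Pfister form p, which is graded. *)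
Lemma pi_op_pow n d u : fundI_pow n.+1 u -> fundI_pow (n.+1 * d) (pi_op n.+1 d u).
Proof.
move=> Iu; rewrite pi_opE -/(pi_series n u); move: u Iu d.
have IN := @fundIN K.
apply: (@fundI_pow_ind _ two0 n (fun u => graded (@fundI K) n.+1 (pi_series n u))).
- by rewrite pi_series0; apply: graded1.
- move=> u v Iu Iv; apply: (graded_div IN Iu Iv); first exact: pi_series_c0.
  by apply: etrans (esym (pi_seriesD n _ _)) _; rewrite subrK.
- move=> s sz s0; rewrite pi_series_pfister //; apply: graded_1CX.
  exact: (@pfister_pow K n.+1 s sz).
Qed.

End PiOperations.

(** * The maps f_n and the final formula *)
Lemma fundI_pow_addl (K : fieldType) m n (u : GW K) :
  fundI_pow (m + n) u -> fundI_pow n u.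
Proof. exact: ideal_pow_addl (@fundIN K) _ _ _. Qed.

Section CoefficientTheory.
Variables (k : fieldType) (A : coefficient_theory k).
Hypothesis hk : 2%N \notin [pchar k].

Lemma fe_two0 (K : field_ext k) : 2%:R != 0 :> K.
Proof. by rewrite -(rmorph_nat (fe_emb K)) fmorph_eq0; move: hk; rewrite inE. Qed.

Section OneField.
Variable K : field_ext k.
Implicit Types (u v x : GW K) (s : seq K).
Let two0 := fe_two0 K.
Let IN := @fundIN K.

Lemma ct_f0 m : (0 < m)%N -> ct_f A m (0 : GW K) = 0.
Proof.
move=> m0; have I0 := ideal_pow0 (@fundI K) m.
by apply: (@addrI _ (ct_f A m (0 : GW K))); rewrite -ct_f_add // !addr0.
Qed.

Lemma ct_fB m u v : (0 < m)%N -> fundI_pow m u -> fundI_pow m v ->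
  ct_f A m (u - v) = ct_f A m u - ct_f A m v.
Proof.
move=> m0 Iu Iv; apply: (@addIr _ (ct_f A m v)); rewrite subrK -ct_f_add ?subrK //.
exact: ideal_powB.
Qed.

Lemma ct_f_sum m J (r : seq J) (P : pred J) (F : J -> GW K) : (0 < m)%N ->
    (forall j, P j -> fundI_pow m (F j)) ->
  ct_f A m (\sum_(j <- r | P j) F j) = \sum_(j <- r | P j) ct_f A m (F j).
Proof.
move=> m0 IF.
suff [] : ct_f A m (\sum_(j <- r | P j) F j) = \sum_(j <- r | P j) ct_f A m (F j) /\
   fundI_pow m (\sum_(j <- r | P j) F j) by [].
elim/big_rec2: _ => [|j y x Pj [<- Ix]]; first by rewrite ct_f0 //; split=> //; apply: ideal_pow0.
by rewrite ct_f_add //; [split=> //; apply: ideal_powD => // | ]; apply: IF.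
Qed.

Lemma ct_fMn m u N : (0 < m)%N -> fundI_pow m u -> ct_f A m (u *+ N) = ct_f A m u *+ N.
Proof.
move=> m0 Iu; elim: N => [|N IH]; first exact: ct_f0.
by rewrite !mulrS ct_f_add ?IH //; apply: ideal_powMn.
Qed.

Lemma ct_f_symb s : (0 < size s)%N -> nonzero s ->
  ct_f A (size s) (pfister s) = symb (ct_f A 1) s.
Proof. by move=> s0 /allP nz; have := @ct_f_pfister _ A _ K (in_tuple s) s0 nz. Qed.

Lemma symb_cons a s : symb (ct_f A 1) (a :: s) = ct_f A 1 (pf1 a) * symb (ct_f A 1) s.
Proof. by rewrite /symb big_cons. Qed.

(** Both sides are additive in u, and they agree on Pfister forms because f_n maps
    these to products of symbols. *)
Lemma ct_f_pf1M m a u : (0 < m)%N -> a != 0 -> fundI_pow m u ->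
  ct_f A m.+1 (pf1 a * u) = ct_f A 1 (pf1 a) * ct_f A m u.
Proof.
case: m => // m _ a0 Iu.
have Ia : fundI (pf1 a) := fundI_pf1 a.
suff [] : fundI_pow m.+1 u /\ ct_f A m.+2 (pf1 a * u) = ct_f A 1 (pf1 a) * ct_f A m.+1 u by [].
move: u Iu; apply: (fundI_pow_ind two0).
- by split; [apply: ideal_pow0 | rewrite mulr0 !ct_f0 // mulr0].
- move=> u v [Iu eu] [Iv ev]; split; first exact: ideal_powB.
  by rewrite mulrBr (@ct_fB m.+2) ?(@ct_fB m.+1) ?eu ?ev ?mulrBr //; apply: ideal_powS.
- move=> s sz s0; split; first exact: pfister_pow.
  rewrite -pfister_cons -sz ct_f_symb ?sz //.
  have := @ct_f_symb (a :: s) isT; rewrite /= sz => ->.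
    by rewrite symb_cons.
  by rewrite /nonzero /= a0.
Qed.

Lemma ct_f_pf1XM m r a u : (0 < m)%N -> a != 0 -> fundI_pow m u ->
  ct_f A (r + m) (pf1 a ^+ r * u) = ct_f A 1 (pf1 a) ^+ r * ct_f A m u.
Proof.
move=> m0 a0 Iu.
suff [] : fundI_pow (r + m) (pf1 a ^+ r * u) /\
   ct_f A (r + m) (pf1 a ^+ r * u) = ct_f A 1 (pf1 a) ^+ r * ct_f A m u by [].
elim: r => [|r [Ir er]]; first by rewrite !mul1r.
rewrite !exprS -!mulrA; split; first by apply: ideal_powS => //; apply: fundI_pf1.
by rewrite addSn ct_f_pf1M ?addn_gt0 ?m0 ?orbT // er.
Qed.

End OneField.

Notation delta_at K := (frf_map A (fe_base_hom K) (delta A)).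

(** The element delta exists: f_1, restricted to 2-fold Pfister forms, is an invariant
    of the form x + y f_2, where x = 0 because <<1, 1>> = 0, and both sides are additive. *)
Lemma delta_spec (K : field_ext k) (x : GW K) : fundI_pow 2 x ->
  ct_f A 1 x = delta_at K * ct_f A 2 x.
Proof.
have PfI n (L : field_ext k) (z : GW L) : Pf n z -> fundI_pow n z.
  by case=> s [_ ->]; apply: pfister_pow; apply: size_tuple.
pose alpha (L : field_ext k) (h : fe_hom (fe_base k) L) (z : GW L) := ct_f A 1 z.
have inv : is_Pf_invariant 2 alpha.
  move=> L M h h' g _ z /PfI Iz; apply: ct_f1_natural.
  exact: (@fundI_pow_addl L 1 1 z Iz).
have [[x0 y] [/= xyP _]] := @ct_Pf_invariants _ A (fe_base k) 2 alpha isT inv.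
suff ex : exists y : A (fe_base k), forall (K : field_ext k) (x : GW K), fundI_pow 2 x ->
    ct_f A 1 x = frf_map A (fe_base_hom K) y * ct_f A 2 x.
  by have := xgetPex 0 ex; apply.
exists y => {K x} K x Ix.
have x00 : frf_map A (fe_base_hom K) x0 = 0.
  have := xyP K (fe_base_hom K) 0; rewrite /alpha !ct_f0 // mulr0 addr0 => <- //.
  exists [tuple 1; 1]; split; first by move=> a; rewrite !inE orbb => /eqP ->; apply: oner_neq0.
  by rewrite /pfister big_cons /pf1 gw_line1 subrr mul0r.
suff [] : fundI_pow 2 x /\ ct_f A 1 x = frf_map A (fe_base_hom K) y * ct_f A 2 x by [].
have I21 (u : GW K) : fundI_pow 2 u -> fundI_pow 1 u.
  by move=> Iu; exact: (@fundI_pow_addl K 1 1 u Iu).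
move: x Ix; apply: (fundI_pow_ind (fe_two0 K)).
- by split; [apply: ideal_pow0 | rewrite !ct_f0 // mulr0].
- move=> u v [Iu eu] [Iv ev]; split; first by apply: ideal_powB => //; apply: fundIN.
  by rewrite !ct_fB ?eu ?ev ?mulrBr //; apply: I21.
- move=> s sz s0; split; first exact: pfister_pow.
  have := xyP K (fe_base_hom K) (pfister s); rewrite x00 add0r; apply.
  by exists (Tuple (introT eqP sz)); split=> //; apply/allP.
Qed.

(** On an (m+1)-fold Pfister form <<a, b>> p, the decomposition <<a>> + <<b>> - <<a b>> of
    <<a, b>> turns f_m(<<a, b>> p) into f_1(<<a, b>>) times the symbol of p, and the
    definition of delta applies to the first factor. *)
Lemma ct_f_restrict1 (K : field_ext k) m (x : GW K) : (0 < m)%N -> fundI_pow m.+1 x ->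
  ct_f A m x = delta_at K * ct_f A m.+1 x.
Proof.
case: m => // m _; have IN := @fundIN K.
have sub n (u : GW K) : fundI_pow n.+1 u -> fundI_pow n u.
  by move=> Iu; exact: (@fundI_pow_addl K 1 n u Iu).
move=> Ix.
suff [] : fundI_pow m.+2 x /\ ct_f A m.+1 x = delta_at K * ct_f A m.+2 x by [].
move: x Ix; apply: (fundI_pow_ind (fe_two0 K)).
- by split; [apply: ideal_pow0 | rewrite !ct_f0 // mulr0].
- move=> u v [Iu eu] [Iv ev]; split; first exact: ideal_powB.
  by rewrite !ct_fB ?eu ?ev ?mulrBr //; apply: sub.
- move=> [|a [|b s]] // [sz] nz; split; first by apply: pfister_pow; rewrite /= sz.
  have [a0 b0 s0] := and3P nz; have ab0 : a * b != 0 by apply: mulf_neq0.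
  have nzc c : c != 0 -> nonzero (c :: s) by move=> c0; rewrite /nonzero /= c0.
  have fE c : c != 0 -> ct_f A m.+1 (pfister (c :: s)) =
      ct_f A 1 (pf1 c) * symb (ct_f A 1) s.
    by move=> c0; rewrite -sz -symb_cons -[(size s).+1]/(size (c :: s)) ct_f_symb ?nzc.
  have I1 (c : K) : fundI_pow 1 (pf1 c).
    by have := @pfister_pow K 1 [:: c] erefl; rewrite /pfister big_seq1.
  have IS (c : K) : fundI_pow m.+1 (pfister (c :: s)) by apply: pfister_pow; rewrite /= sz.
  have fab : ct_f A 2 (pf1 a * pf1 b) = ct_f A 1 (pf1 a) * ct_f A 1 (pf1 b).
    have := @ct_f_symb K [:: a; b] isT; rewrite pfister_cons /pfister big_seq1 => ->.
      by rewrite /symb !big_cons big_nil mulr1.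
    by rewrite /nonzero /= a0 b0.
  have sz2 : size [:: a, b & s] = m.+2 by rewrite /= sz.
  have -> : ct_f A m.+2 (pfister [:: a, b & s]) =
      ct_f A 2 (pf1 a * pf1 b) * symb (ct_f A 1) s.
    by rewrite -sz2 ct_f_symb // !symb_cons fab mulrA.
  have -> : pfister [:: a, b & s] = pfister (a :: s) + pfister (b :: s) - pfister (a * b :: s).
    by rewrite !pfister_cons mulrA pf1M // mulrBl mulrDl.
  rewrite [LHS]ct_fB // ?ct_f_add //; last exact: (ideal_powD IN (IS a) (IS b)).
  rewrite !fE // -mulrDl -mulrBl -ct_f_add // -ct_fB //; last exact: (ideal_powD IN (I1 a) (I1 b)).
  rewrite -pf1M // delta_spec ?mulrA //.
  by have := @pfister_pow K 2 [:: a; b] erefl; rewrite pfister_cons /pfister big_seq1.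
Qed.

Lemma ct_f_restrict (K : field_ext k) m j (x : GW K) : (0 < m)%N -> fundI_pow (m + j) x ->
  ct_f A m x = delta_at K ^+ j * ct_f A (m + j) x.
Proof.
move=> m0; elim: j => [|j IH]; first by rewrite addn0 mul1r.
rewrite addnS => Ix; rewrite IH; last exact: (@fundI_pow_addl K 1).
by rewrite ct_f_restrict1 ?addn_gt0 ?m0 // exprSr mulrA.
Qed.

End CoefficientTheory.

Theorem proposition1p2p54 (k : fieldType) (hk : 2%N \notin [pchar k])
    (A : coefficient_theory k) (n d : nat) (hn : (1 <= n)%N) (hd : (1 <= d)%N)
    (K : field_ext k) (x : GW K) (hx : fundI_pow n.+1 x) :
  f_op A n d x =
    \sum_(j < d.+1 | (d <= 2 * j)%N)
      (frf_map A (fe_base_hom K) (delta A) ^+ (2 * j - d)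
       * symb (ct_f A 1) [:: -1] ^+ ((d - j) * (n - 1))
       * f_op A n.+1 j x) *+ 'C(j, d - j).
Proof.
have two0 := fe_two0 hk K; have IN := @fundIN K.
case: n hn hx => // n _ hx.
have f_opE m e : (0 < e)%N -> f_op A m e x = ct_f A (m * e) (pi_op m e x) by case: e.
have nd0 : (0 < n.+1 * d)%N by rewrite muln_gt0.
(* the terms with 2 j < d vanish, their binomial coefficient being zero *)
rewrite f_opE // pi_op_rec (bigID (fun j : 'I_d.+1 => d <= 2 * j)%N) /=.
rewrite [X in _ + X]big1 ?addr0; last first.
  move=> j; rewrite -ltnNge => lt_jd.
  have lt_j : (j < d - j)%N by rewrite ltn_subRL addnn -mul2n.
  by rewrite bin_small // mulr0n mul0r mulr0.
(* the power of the augmentation ideal that really contains the j-th term *)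
have deg j : (d <= 2 * j)%N -> (j <= d)%N ->
    (n.+1 * d + (2 * j - d) = n * (d - j) + n.+2 * j)%N.
  move=> le_dj le_jd; have nd : (n * d = n * (d - j) + n * j)%N by rewrite -mulnDr subnK.
  by rewrite !mulSn nd; lia.
have term (j : 'I_d.+1) : (d <= 2 * j)%N ->
    pi_op n.+2 j x * ('C(j, d - j)%:R * 2%:R ^+ (n * (d - j))) =
    pf1 (-1) ^+ (n * (d - j)) * pi_op n.+2 j x *+ 'C(j, d - j) /\
    fundI_pow (n.+1 * d + (2 * j - d)) (pf1 (-1) ^+ (n * (d - j)) * pi_op n.+2 j x).
  move=> le_dj; have Ij := pi_op_pow two0 j hx.
  have j0 : (0 < n.+2 * j)%N by rewrite muln_gt0 /=; lia.
  split.
    rewrite -natrX mulrCA mulr_natl mulr_natr; congr (_ *+ _).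
    by move: (n.+2 * j)%N j0 Ij => [|M] // _ Ij; apply: (fundI_pow_2X two0 _ Ij).
  rewrite deg -1?ltnS //; apply: ideal_powM => //.
  elim: (n * (d - j))%N => // r IH; rewrite exprS; apply: ideal_powS => //.
  exact: fundI_pf1.
rewrite (eq_bigr (fun j : 'I_d.+1 =>
   pf1 (-1) ^+ (n * (d - j)) * pi_op n.+2 j x *+ 'C(j, d - j))); last first.
  by move=> j /term[].
have term_in (j : 'I_d.+1) : (d <= 2 * j)%N ->
    fundI_pow (n.+1 * d) (pf1 (-1) ^+ (n * (d - j)) * pi_op n.+2 j x).
  move=> /term[_]; rewrite addnC; exact: fundI_pow_addl.
rewrite ct_f_sum //; last first.
  by move=> j /term_in; apply: ideal_powMn.
apply: eq_bigr => j le_dj; rewrite ct_fMn //; last exact: term_in.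
congr (_ *+ _); have [_ Ij] := term j le_dj.
have j0 : (0 < j)%N by lia.
rewrite (ct_f_restrict A hk nd0 Ij) deg -1?ltnS // -mulrA; congr (_ * _).
rewrite f_opE // subn1 /= [((d - j) * n)%N]mulnC /symb big_seq1.
apply: (ct_f_pf1XM A hk) => //; first by rewrite muln_gt0.
  by rewrite oppr_eq0 oner_neq0.
exact: pi_op_pow.
Qed.
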